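(* Let $q\in(0,1)$ and $\nu>-1$. Then the radius of starlikeness $r^*\left(g_{\nu}^{(3)}(\cdot;q)\right)$ of the function $$z\mapsto g_{\nu}^{(3)}(z;q)=c_{\nu}(q)z^{1-\nu}J_{\nu}^{(3)}(z;q)$$ is the smallest positive root of the equation $r\cdot \frac{d}{dr}J_{\nu}^{(3)}(r;q)-(\nu-1)J_{\nu}^{(3)}(r;q)=0$ and satisfies $$\sqrt{\frac{(1-q)(1-q^{\nu+1})}{3q}}<r^*\left(g_{\nu}^{(3)}(\cdot;q)\right)<\sqrt{\frac{3(q^{\nu+1}-1)(q^{\nu+2}-1)(q^2-1)}{q(9q^{\nu+3}-q^{\nu+2}+q-9)}}$$ and $$\sqrt[4]{\frac{(q^{\nu+1}-1)^2(q-1)^2(q^{\nu+2}-1)(q+1)}{q^2(9q^{\nu+3}-q^{\nu+2}+q-9)}}<r^*\left(g_{\nu}^{(3)}(\cdot;q)\right)< \sqrt{\frac{(q-1)(q^{\nu+1}-1)(q^{\nu+3}-1)}{3q(q+1)}\,q_3^*(\nu)},$$ where $$q_3^*(\nu)=\frac{(9q^{\nu+3}-q^{\nu+2}+q-9)(q^3+2q^2+2q+1)}{s_{\nu}(q)+r_{\nu}(q)},$$ $$s_{\nu}(q)=6q^{\nu+2}-12q^{\nu+3}-20q^{\nu+4}-12q^{\nu+5}+6q^{\nu+6}+q^{2\nu+5},$$ $$r_{\nu}(q)=3q^{2\nu+6}+3q^{2\nu+7}+9q^{2\nu+8}+q^3+3q^2+3q+9.$$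
   Context: For $a\in\mathbb{C}$ and $q\in(0,1)$: $(a;q)_0=1$, $(a;q)_n=\prod_{k=1}^{n}(1-aq^{k-1})$, $(a;q)_\infty=\prod_{k\geq1}(1-aq^{k-1})$. The Hahn–Exton $q$-Bessel function is, for $\nu>-1$, $$J_{\nu}^{(3)}(z;q)=\frac{(q^{\nu+1};q)_{\infty}}{(q;q)_{\infty}}\sum_{n\geq0}\frac{(-1)^{n}z^{2n+\nu}}{(q;q)_{n}(q^{\nu+1};q)_{n}}q^{\frac{1}{2}n(n+1)},$$ and $c_{\nu}(q)=(q;q)_{\infty}/(q^{\nu+1};q)_{\infty}$; thus $g_\nu^{(3)}(\cdot;q)$ is entire with $g(0)=0$, $g'(0)=1$. For such $f$, the radius of starlikeness is $r^*(f)=\sup\{r>0:\ \mathrm{Re}\,(zf'(z)/f(z))>0 \text{ for all } |z|<r\}$. *)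

(* Defs.v *)
From Stdlib Require Import Reals.
From Coquelicot Require Import Coquelicot.
Open Scope R_scope.

Fixpoint qpoch (a q : R) (n : nat) : R :=
  match n with
  | O => 1
  | S m => qpoch a q m * (1 - a * q ^ m)
  end.

Definition qpoch_inf (a q : R) : R := Lim_seq (fun n => qpoch a q n).

Definition c_nu (nu q : R) : R := qpoch_inf q q / qpoch_inf (Rpower q (nu + 1)) q.

Definition hex_coef (nu q : R) (n : nat) : R :=
  (-1) ^ n * Rpower q (INR n * (INR n + 1) / 2)
  / (qpoch q q n * qpoch (Rpower q (nu + 1)) q n).

(* Hahn-Exton q-Bessel function on the positive real axis (r > 0):
   J_nu^(3)(r;q) = (q^(nu+1);q)_oo/(q;q)_oo * sum_n coef_n r^(2n+nu) *)
Definition J3 (nu q r : R) : R :=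
  qpoch_inf (Rpower q (nu + 1)) q / qpoch_inf q q
  * Series (fun n => hex_coef nu q n * Rpower r (2 * INR n + nu)).

Definition CSeries (a : nat -> C) : C :=
  (Series (fun n => Re (a n)), Series (fun n => Im (a n))).

(* g_nu^(3)(z;q) = c_nu(q) z^(1-nu) J_nu^(3)(z;q), where the product
   z^(1-nu) z^(2n+nu) = z^(2n+1) has been carried out termwise, so that
   g is the entire function
   c_nu(q) * (q^(nu+1);q)_oo/(q;q)_oo * sum_n coef_n z^(2n+1). *)
Definition g3 (nu q : R) (z : C) : C :=
  Cmult (RtoC (c_nu nu q))
  (Cmult (RtoC (qpoch_inf (Rpower q (nu + 1)) q / qpoch_inf q q))
     (CSeries (fun n => Cmult (RtoC (hex_coef nu q n)) (Cpow z (2 * n + 1)%nat)))).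

(* f is starlike on the disk |z| < r : Re (z f'(z) / f(z)) > 0 for |z| < r
   (z <> 0; at z = 0 the quotient is understood as its limit value 1). *)
Definition starlike_on (f : C -> C) (r : R) : Prop :=
  forall z : C, 0 < Cmod z < r ->
    exists l : C, is_derive (K := C_AbsRing) (V := C_NormedModule) f z l
                  /\ 0 < Re (Cdiv (Cmult z l) (f z)).

Definition radius_starlike (f : C -> C) : Rbar :=
  Lub_Rbar (fun r => 0 < r /\ starlike_on f r).

(* Main.v *)
Require Import Defs.
From Stdlib Require Import Reals Lra Lia List Classical IndefiniteDescription.
From Coquelicot Require Import Coquelicot.
Open Scope R_scope.

(** Write [c = q^(nu+1)] and [g(z) = z P(z^2)], with [P(w) = sum_k (-1)^k h_k w^k].
    Then [g'(z) = Q(z^2)] with [Q = P + 2 w P'], and [F(x)] is a positive multiple of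
    [x^nu Q(x^2)]. [P] is the limit of the rescaled Wall polynomials
    [P_N(w) = p_N(q^N w)], whose roots are positive by a Sturm argument on their
    three-term recurrence; evaluating [Q_N = P_N + 2 w P_N'] at the roots of [P_N]
    shows that [Q_N] has only positive roots too, the smallest one below those
    of [P_N].

    With [1/t] ranging over the roots, [P_N(w) = prod (1 - t w)], so
    [|w P_N'(w) / P_N(w)|] is at most its value at [|w|] as long as [|w|] is below
    the smallest root. Letting [N] grow, [|2 w P'| < |P|] for [|w|] below the
    first positive root [gamma] of [Q], hence [Re (z g'/g) > 0] for
    [|z| < sqrt gamma], while [g'(sqrt gamma) = 0].

    The bounds are the Euler-Rayleigh inequalities
    [p_k^(-1/k) < gamma < p_k / p_(k+1)], [k = 1, 2], for the power sums [p_k] of the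
    reciprocal roots of [Q], computed from its coefficients by Newton's identities. *)

(** * Elementary symmetric functions and power sums of reciprocal roots *)

(** The limit functions are never factored over their roots, and these are not shown to be real:
    root products and power sums exist only for the approximants. They pass to the limit because
    power sums are polynomials in the first coefficients and because the rescaled Wall coefficients
    are dominated by the limit ones, each factor q^m being replaced by q^m - q^N. The operator x
    d/dx is carried along algebraically on the products. The obstacle is strictness, since limits
    only give gamma p_(k+1) <= p_k. Equality for k = 2 would mean that no weight t^2 (1/gamma - t)
    survives in the limit, as for a function (1 - x/gamma)^m exp(-a x). Newton's identities turn
    this degeneration into a linear relation between consecutive coefficients, which their fast
    decay refutes; strictness for k = 1 and the existence of gamma itself follow from it. *)

Fixpoint esym (l : list R) (n : nat) : R :=
  match l, n with
  | nil, O => 1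
  | nil, S _ => 0
  | _ :: _, O => 1
  | t :: l', S m => esym l' (S m) + t * esym l' m
  end.

Fixpoint psum (l : list R) (k : nat) : R :=
  match l with
  | nil => 0
  | t :: l' => t ^ k + psum l' k
  end.

Fixpoint rprod (l : list R) (x : R) : R :=
  match l with
  | nil => 1
  | t :: l' => (1 - t * x) * rprod l' x
  end.

(** The Euler operator x d/dx applied to [rprod l], unfolded by the product rule. *)
Fixpoint rtheta (l : list R) (x : R) : R :=
  match l with
  | nil => 0
  | t :: l' => (1 - t * x) * rtheta l' x - t * x * rprod l' x
  end.

Lemma esym_0 l : esym l 0 = 1.
Proof. destruct l; reflexivity. Qed.

Lemma esym_cons t l n : esym (t :: l) (S n) = esym l (S n) + t * esym l n.
Proof. reflexivity. Qed.

Lemma esym_ge0 l : (forall t, In t l -> 0 < t) -> forall n, 0 <= esym l n.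
Proof.
  induction l as [|t l IH]; intros H [|n]; simpl; try lra.
  assert (Hl : forall n, 0 <= esym l n) by (apply IH; intros; apply H; now right).
  assert (0 < t) by (apply H; now left).
  apply Rplus_le_le_0_compat; [apply Hl|].
  apply Rmult_le_pos; [lra|apply Hl].
Qed.

Lemma esym_scale s l n : esym (map (fun t => t * s) l) n = esym l n * s ^ n.
Proof.
  revert n; induction l as [|t l IH]; intros [|n]; simpl; try ring.
  rewrite !IH; simpl; ring.
Qed.

Lemma psum_1 l : psum l 1 = esym l 1.
Proof.
  induction l as [|t l IH]; [reflexivity|].
  rewrite esym_cons, esym_0; simpl psum; rewrite IH; ring.
Qed.

Lemma psum_2 l : psum l 2 = esym l 1 ^ 2 - 2 * esym l 2.
Proof.
  induction l as [|t l IH]; [simpl; ring|].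
  rewrite !esym_cons, esym_0; simpl psum; rewrite IH; ring.
Qed.

Lemma psum_3 l : psum l 3 = esym l 1 ^ 3 - 3 * esym l 1 * esym l 2 + 3 * esym l 3.
Proof.
  induction l as [|t l IH]; [simpl; ring|].
  rewrite !esym_cons, esym_0; simpl psum; rewrite IH; ring.
Qed.

Lemma psum_ge0 l k : (forall t, In t l -> 0 < t) -> 0 <= psum l k.
Proof.
  induction l as [|t l IH]; intros H; simpl; [lra|].
  assert (0 < t) by (apply H; now left).
  assert (0 < t ^ k) by now apply pow_lt.
  assert (0 <= psum l k) by (apply IH; intros; apply H; now right).
  lra.
Qed.

Lemma psum_in l k t : (forall t, In t l -> 0 < t) -> In t l -> t ^ k <= psum l k.
Proof.
  induction l as [|a l IH]; intros H; simpl; [tauto|].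
  assert (0 < a ^ k) by (apply pow_lt, H; now left).
  intros [->|Hi].
  - assert (0 <= psum l k) by (apply psum_ge0; intros; apply H; now right). lra.
  - assert (t ^ k <= psum l k) by (apply IH; [intros; apply H; now right|easy]). lra.
Qed.

(** Termwise t^k (1 - t x) >= 0 when x lies below all roots 1/t; this is the source of the upper
    Euler-Rayleigh bounds. *)
Lemma psum_S_le l x k :
  (forall t, In t l -> 0 < t /\ t * x <= 1) -> x * psum l (S k) <= psum l k.
Proof.
  induction l as [|a l IH]; intros H; simpl; [lra|].
  destruct (H a) as [Ha Hax]; [now left|].
  assert (0 < a ^ k) by now apply pow_lt.
  assert (x * psum l (S k) <= psum l k) by (apply IH; intros; apply H; now right).
  nra.
Qed.

(** Termwise t^2 (1 - t x) <= T t (1 - t x). It bounds the gap in the second inequality by the gap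
    in the first, so that strictness of the second gives strictness of the first. *)
Lemma psum_gap l x T :
  (forall t, In t l -> 0 < t /\ t * x <= 1 /\ t <= T) ->
  psum l 2 - x * psum l 3 <= T * (psum l 1 - x * psum l 2).
Proof.
  induction l as [|a l IH]; intros H; simpl; [lra|].
  destruct (H a) as (Ha & Hax & HaT); [now left|].
  assert (psum l 2 - x * psum l 3 <= T * (psum l 1 - x * psum l 2))
    by (apply IH; intros; apply H; now right).
  assert (0 <= (T - a) * (a * (1 - a * x))) by
    (apply Rmult_le_pos; [lra|apply Rmult_le_pos; lra]).
  nra.
Qed.

(* The two parts of the quantity below are [X (n+1) - p2 * e (n+1) = - sum_j t_j^3 e_n^(j)]
   and [g * X n = g * sum_j t_j^2 e_n^(j)], where [e^(j)] omits the variable [t_j]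
   and [X n = sum_j t_j^2 e_n^(j)]; so it equals [sum_j t_j^2 (g - t_j) e_n^(j)]. *)
Definition newton_defect (e : nat -> R) (p1 p2 g : R) (n : nat) : R :=
  p1 * e (n + 2)%nat - INR (n + 3) * e (n + 3)%nat - p2 * e (n + 1)%nat
  + g * (p1 * e (n + 1)%nat - INR (n + 2) * e (n + 2)%nat).

(** In the sum over j, the old roots change by e_(n+1)^(j) -> e_(n+1)^(j) + t e_n^(j), and the last
    summand is the contribution of the new root [t]. *)
Lemma newton_defect_cons_S t l g n :
  newton_defect (esym (t :: l)) (psum (t :: l) 1) (psum (t :: l) 2) g (S n)
  = newton_defect (esym l) (psum l 1) (psum l 2) g (S n)
    + t * newton_defect (esym l) (psum l 1) (psum l 2) g n
    + t ^ 2 * (g - t) * esym l (S n).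
Proof.
  unfold newton_defect.
  replace (S n + 2)%nat with (S (S (S n))) by lia.
  replace (S n + 3)%nat with (S (S (S (S n)))) by lia.
  replace (S n + 1)%nat with (S (S n)) by lia.
  replace (n + 2)%nat with (S (S n)) by lia.
  replace (n + 3)%nat with (S (S (S n))) by lia.
  replace (n + 1)%nat with (S n) by lia.
  rewrite !esym_cons, !S_INR; simpl psum; ring.
Qed.

Lemma newton_defect_cons_0 t l g :
  newton_defect (esym (t :: l)) (psum (t :: l) 1) (psum (t :: l) 2) g 0
  = newton_defect (esym l) (psum l 1) (psum l 2) g 0 + t ^ 2 * (g - t).
Proof.
  unfold newton_defect.
  cbn [Nat.add]; rewrite !esym_cons, esym_0; simpl psum.
  rewrite psum_2, psum_1; simpl INR; ring.
Qed.

(** In the sum formula each summand t_j^2 (g - t_j) e_n^(j) is nonnegative, and e_n^(j) <= e_n. The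
    upper bound collapses to 0 when g p2 = p3, which is how equality in an Euler-Rayleigh bound
    makes the defect vanish. *)
Lemma newton_defect_bounds l g :
  (forall t, In t l -> 0 < t <= g) -> forall n,
  0 <= newton_defect (esym l) (psum l 1) (psum l 2) g n
    <= (g * psum l 2 - psum l 3) * esym l n.
Proof.
  induction l as [|t l IH]; intros H n.
  - unfold newton_defect.
    replace (n + 2)%nat with (S (S n)) by lia.
    replace (n + 3)%nat with (S (S (S n))) by lia.
    replace (n + 1)%nat with (S n) by lia.
    simpl; lra.
  - assert (Hl : forall t, In t l -> 0 < t <= g) by (intros; apply H; now right).
    assert (Ht : 0 < t <= g) by (apply H; now left).
    assert (E := esym_ge0 l (fun t h => proj1 (Hl t h))).
    specialize (IH Hl).
    assert (Hd : 0 <= g * psum l 2 - psum l 3).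
    { clear -Hl; induction l as [|t l IH]; simpl; [lra|].
      assert (0 < t <= g) by (apply Hl; now left).
      assert (0 <= g * psum l 2 - psum l 3) by (apply IH; intros; apply Hl; now right).
      assert (0 <= t * t * (g - t)) by (apply Rmult_le_pos; [apply Rmult_le_pos|]; lra).
      lra. }
    assert (Hg : 0 <= t ^ 2 * (g - t)) by (apply Rmult_le_pos; [apply pow2_ge_0|lra]).
    destruct n as [|n].
    + rewrite newton_defect_cons_0, esym_0; specialize (IH 0%nat); rewrite esym_0 in IH.
      simpl psum; lra.
    + rewrite newton_defect_cons_S.
      assert (I1 := IH (S n)); assert (I2 := IH n).
      assert (P1 : 0 <= t ^ 2 * (g - t) * esym l (S n))
        by (apply Rmult_le_pos; [exact Hg|apply E]).
      assert (P2 : 0 <= t ^ 2 * (g - t) * (t * esym l n))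
        by (apply Rmult_le_pos; [exact Hg|apply Rmult_le_pos; [lra|apply E]]).
      assert (P3 := Rmult_le_compat_l t _ _ (Rlt_le _ _ (proj1 Ht)) (proj2 I2)).
      assert (P4 := Rmult_le_pos _ _ (Rlt_le _ _ (proj1 Ht)) (proj1 I2)).
      split; [lra|].
      rewrite esym_cons; simpl psum; nra.
Qed.

(** From 1/(1 - u) = 1 + u/(1 - u) <= 1 + u/d <= exp(u/d). *)
Lemma one_minus_ge_exp u d : 0 <= u -> 0 < d -> u <= 1 - d -> exp (- (u / d)) <= 1 - u.
Proof.
  intros Hu Hd Hud.
  rewrite exp_Ropp.
  rewrite <- (Rinv_inv (1 - u)).
  apply Rinv_le_contravar; [apply Rinv_0_lt_compat; lra|].
  assert (H : 1 + u / (1 - u) <= exp (u / d)).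
  { apply Rle_trans with (1 + u / d).
    - apply Rplus_le_compat_l, Rmult_le_compat_l; [lra|].
      apply Rinv_le_contravar; lra.
    - apply exp_ineq1_le. }
  replace (/ (1 - u)) with (1 + u / (1 - u)) by (field; lra).
  exact H.
Qed.

(** The bound depends on the list only through its sum, not its length, so it keeps a whole sequence
    of products away from 0. *)
Lemma rprod_ge_exp l x d : 0 <= x -> 0 < d ->
  (forall t, In t l -> 0 < t /\ t * x <= 1 - d) ->
  exp (- (x * psum l 1 / d)) <= rprod l x.
Proof.
  intros Hx Hd; induction l as [|t l IH]; intros H; simpl.
  - replace (- (x * 0 / d)) with 0 by (field; lra). rewrite exp_0; lra.
  - destruct (H t) as [Ht Htx]; [now left|].
    replace (- (x * (t * 1 + psum l 1) / d))
      with (- (t * x / d) + - (x * psum l 1 / d)) by (field; lra).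
    rewrite exp_plus.
    apply Rmult_le_compat; try (left; apply exp_pos).
    + apply one_minus_ge_exp; nra.
    + apply IH; intros; apply H; now right.
Qed.

Lemma rprod_root l t : In t l -> t <> 0 -> rprod l (/ t) = 0.
Proof.
  intros Hi Ht; induction l as [|a l IH]; [destruct Hi|]; simpl.
  destruct Hi as [->|Hi]; [rewrite Rinv_r by easy|rewrite IH by easy]; ring.
Qed.

(** * Products over reciprocal roots at complex points *)

Fixpoint lprod (l : list R) (z : C) : C :=
  match l with
  | nil => RtoC 1
  | t :: l' => Cmult (Cminus (RtoC 1) (Cmult (RtoC t) z)) (lprod l' z)
  end.

Fixpoint ltheta (l : list R) (z : C) : C :=
  match l with
  | nil => RtoC 0
  | t :: l' => Cminus (Cmult (Cminus (RtoC 1) (Cmult (RtoC t) z)) (ltheta l' z))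
                      (Cmult (Cmult (RtoC t) z) (lprod l' z))
  end.

Lemma lprod_RtoC l x : lprod l (RtoC x) = RtoC (rprod l x).
Proof.
  induction l as [|t l IH]; simpl; [reflexivity|].
  rewrite IH, <- RtoC_mult, <- RtoC_minus, <- RtoC_mult; reflexivity.
Qed.

Lemma ltheta_RtoC l x : ltheta l (RtoC x) = RtoC (rtheta l x).
Proof.
  induction l as [|t l IH]; simpl; [reflexivity|].
  rewrite IH, lprod_RtoC, <- !RtoC_mult, <- RtoC_minus, <- RtoC_mult, <- RtoC_minus.
  reflexivity.
Qed.

Lemma rprod_ge0 l x : (forall t, In t l -> t * x <= 1) -> 0 <= rprod l x.
Proof.
  induction l as [|t l IH]; intros H; simpl; [lra|].
  apply Rmult_le_pos.
  - specialize (H t (or_introl eq_refl)); lra.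
  - apply IH; intros; apply H; now right.
Qed.

Lemma rtheta_le0 l x : 0 <= x -> (forall t, In t l -> 0 < t /\ t * x <= 1) -> rtheta l x <= 0.
Proof.
  intros Hx; induction l as [|t l IH]; intros H; simpl; [lra|].
  destruct (H t (or_introl eq_refl)).
  assert (rtheta l x <= 0) by (apply IH; intros; apply H; now right).
  assert (0 <= rprod l x) by (apply rprod_ge0; intros; apply H; now right).
  assert (0 <= (1 - t * x) * - rtheta l x) by (apply Rmult_le_pos; lra).
  assert (0 <= t * x * rprod l x) by (apply Rmult_le_pos; [apply Rmult_le_pos|]; lra).
  lra.
Qed.

Lemma Cmod_one_minus_ge t z : 0 < t -> 1 - t * Cmod z <= Cmod (Cminus (RtoC 1) (Cmult (RtoC t) z)).
Proof.
  intros Ht.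
  assert (H := Cmod_triangle (Cminus (RtoC 1) (Cmult (RtoC t) z)) (Cmult (RtoC t) z)).
  replace (Cplus (Cminus (RtoC 1) (Cmult (RtoC t) z)) (Cmult (RtoC t) z)) with (RtoC 1) in H by ring.
  rewrite Cmod_1, (Cmod_mult (RtoC t) z), Cmod_R, (Rabs_pos_eq t) in H by lra.
  lra.
Qed.

Lemma lprod_ge l z : (forall t, In t l -> 0 < t /\ t * Cmod z <= 1) ->
  rprod l (Cmod z) <= Cmod (lprod l z).
Proof.
  induction l as [|t l IH]; intros H; simpl; [rewrite Cmod_1; lra|].
  destruct (H t (or_introl eq_refl)).
  rewrite Cmod_mult; apply Rmult_le_compat.
  - lra.
  - apply rprod_ge0; intros; apply H; now right.
  - now apply Cmod_one_minus_ge.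
  - apply IH; intros; apply H; now right.
Qed.

(* Among all points of modulus [r], the logarithmic derivative [z P'(z) / P(z)] is
   largest in modulus at [z = r]; the statement is cleared of denominators. *)
Lemma ltheta_le l z : (forall t, In t l -> 0 < t /\ t * Cmod z <= 1) ->
  Cmod (ltheta l z) * rprod l (Cmod z) <= - rtheta l (Cmod z) * Cmod (lprod l z).
Proof.
  induction l as [|t l IH]; intros H; simpl; [rewrite Cmod_0, Cmod_1; lra|].
  destruct (H t (or_introl eq_refl)) as [Ht Htz].
  assert (Hl : forall t, In t l -> 0 < t /\ t * Cmod z <= 1) by (intros; apply H; now right).
  specialize (IH Hl).
  assert (Hp := rprod_ge0 l (Cmod z) (fun t h => proj2 (Hl t h))).
  assert (Hth := rtheta_le0 l (Cmod z) (Cmod_ge_0 z) Hl).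
  set (m := Cminus (RtoC 1) (Cmult (RtoC t) z)) in *.
  assert (Hm : 1 - t * Cmod z <= Cmod m) by now apply Cmod_one_minus_ge.
  rewrite (Cmod_mult m (lprod l z)).
  assert (Htri : Cmod (Cminus (Cmult m (ltheta l z)) (Cmult (Cmult (RtoC t) z) (lprod l z)))
                 <= Cmod m * Cmod (ltheta l z) + t * Cmod z * Cmod (lprod l z)).
  { unfold Cminus at 1. eapply Rle_trans; [apply Cmod_triangle|].
    rewrite Cmod_opp, !Cmod_mult, Cmod_R, (Rabs_pos_eq t) by lra. lra. }
  set (p := rprod l (Cmod z)) in *; set (d := rtheta l (Cmod z)) in *.
  set (P := Cmod (lprod l z)) in *; set (D := Cmod (ltheta l z)) in *.
  set (M := Cmod m) in *.
  assert (HP : 0 <= P) by apply Cmod_ge_0.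
  assert (HM : 0 <= M) by apply Cmod_ge_0.
  assert (Hz : 0 <= Cmod z) by apply Cmod_ge_0.
  set (s := t * Cmod z) in *.
  assert (Hs : 0 <= s) by (apply Rmult_le_pos; lra).
  apply Rle_trans with ((M * D + s * P) * ((1 - s) * p)).
  { apply Rmult_le_compat_r; [|exact Htri]. apply Rmult_le_pos; lra. }
  (* The difference of the two sides is the sum of two slacks: the induction hypothesis weighted by
     M (1 - s), and |1 - t z| >= 1 - t |z| weighted by s P p. *)
  assert (H1 : 0 <= M * (1 - s) * (- d * P - D * p)).
  { apply Rmult_le_pos; [apply Rmult_le_pos|]; lra. }
  assert (H2 : 0 <= s * P * p * (M - (1 - s))).
  { apply Rmult_le_pos; [repeat apply Rmult_le_pos|]; lra. }
  lra.
Qed.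

(** * Polynomials determined by sign changes *)

Lemma is_series_C_parts (a : nat -> C) (l : C) :
  is_series (K := C_AbsRing) (V := C_NormedModule) a l ->
  is_series (fun n => Re (a n)) (Re l) /\ is_series (fun n => Im (a n)) (Im l).
Proof.
  intros H.
  assert (E : forall n, sum_n (G := C_AbelianMonoid) a n
              = (sum_n (fun k => Re (a k)) n, sum_n (fun k => Im (a k)) n)).
  { induction n as [|n IH].
    - rewrite !sum_O; now destruct (a 0%nat).
    - rewrite !sum_Sn.
      change (plus (sum_n (G := C_AbelianMonoid) a n) (a (S n)))
        with (Cplus (sum_n (G := C_AbelianMonoid) a n) (a (S n))).
      rewrite IH; reflexivity. }
  split.
  - apply filterlim_ext with (fun n => fst (sum_n (G := C_AbelianMonoid) a n)).
    { intros n; rewrite E; reflexivity. }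
    eapply filterlim_comp; [exact H|].
    destruct l as [lr li]; apply (continuous_fst (U := R_UniformSpace) (V := R_UniformSpace) lr li).
  - apply filterlim_ext with (fun n => snd (sum_n (G := C_AbelianMonoid) a n)).
    { intros n; rewrite E; reflexivity. }
    eapply filterlim_comp; [exact H|].
    destruct l as [lr li]; apply (continuous_snd (U := R_UniformSpace) (V := R_UniformSpace) lr li).
Qed.

(** Bridge between the componentwise [CSeries] and convergence in the normed module of complex
    numbers. *)
Lemma CSeries_unique (a : nat -> C) (l : C) :
  is_series (K := C_AbsRing) (V := C_NormedModule) a l -> CSeries a = l.
Proof.
  intros H; apply is_series_C_parts in H as [H1 H2].
  unfold CSeries; rewrite (is_series_unique _ _ H1), (is_series_unique _ _ H2).
  now destruct l.
Qed.

Notation is_Cseries := (is_series (K := C_AbsRing) (V := C_NormedModule)).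

Lemma is_Cseries_decr_1 (a : nat -> C) (l : C) :
  is_Cseries (fun n => a (S n)) (Cminus l (a 0%nat)) -> is_Cseries a l.
Proof. intros H; now apply is_series_decr_1. Qed.

Lemma is_Cseries_incr_1 (a : nat -> C) (l : C) :
  is_Cseries a l -> is_Cseries (fun n => a (S n)) (Cminus l (a 0%nat)).
Proof.
  intros H; apply (is_series_incr_1 (K := C_AbsRing) (V := C_NormedModule)).
  match goal with |- is_series _ ?m => assert (E : m = l) end.
  { change (Cplus (Cminus l (a 0%nat)) (a 0%nat) = l); ring. }
  rewrite E; exact H.
Qed.

Lemma is_Cseries_minus (a b : nat -> C) (la lb : C) :
  is_Cseries a la -> is_Cseries b lb ->
  is_Cseries (fun n => Cminus (a n) (b n)) (Cminus la lb).
Proof. intros; now apply (is_series_minus (K := C_AbsRing) (V := C_NormedModule)). Qed.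

Lemma is_Cseries_scal (c : C) (a : nat -> C) (l : C) :
  is_Cseries a l -> is_Cseries (fun n => Cmult c (a n)) (Cmult c l).
Proof. intros; now apply (is_series_scal (K := C_AbsRing) (V := C_NormedModule)). Qed.

Lemma is_Cseries_0 : is_Cseries (fun _ => RtoC 0) (RtoC 0).
Proof.
  apply filterlim_ext with (fun _ => RtoC 0).
  - induction x as [|n IH]; [now rewrite sum_O|].
    rewrite sum_Sn, <- IH. symmetry; apply Cplus_0_r.
  - apply filterlim_const.
Qed.

Definition pterm (c : nat -> R) (z : C) (k : nat) : C := Cmult (RtoC (c k)) (Cpow z k).

Definition alt (e : nat -> R) (k : nat) : R := (-1) ^ k * e k.

(** The Euler operator x d/dx on coefficient sequences. *)
Definition ntimes (e : nat -> R) (k : nat) : R := INR k * e k.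

(** The polynomial is written as an infinite series with finitely many nonzero terms, so that it can
    be compared termwise with the entire limit. *)
Lemma lprod_series l z : is_Cseries (pterm (alt (esym l)) z) (lprod l z).
Proof.
  induction l as [|t l IH].
  - apply is_Cseries_decr_1.
    eapply is_series_ext with (fun _ => RtoC 0).
    { intros n; unfold pterm, alt; simpl; rewrite Rmult_0_r; symmetry; apply Cmult_0_l. }
    replace (Cminus (lprod nil z) (pterm (alt (esym nil)) z 0)) with (RtoC 0).
    { apply is_Cseries_0. }
    unfold pterm, alt; simpl; rewrite Rmult_1_l; ring.
  - apply is_Cseries_decr_1.
    eapply is_series_ext with
      (fun n => Cminus (pterm (alt (esym l)) z (S n))
                  (Cmult (Cmult (RtoC t) z) (pterm (alt (esym l)) z n))).
    { intros n; unfold pterm, alt; rewrite esym_cons, Cpow_S.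
      rewrite !RtoC_mult, RtoC_plus, RtoC_mult.
      replace (RtoC ((-1) ^ S n)) with (Copp (RtoC ((-1) ^ n))) by
        (rewrite <- RtoC_opp; f_equal; simpl; ring).
      match goal with |- ?a = ?b => change (a = b :> C) end; ring. }
    replace (Cminus (lprod (t :: l) z) (pterm (alt (esym (t :: l))) z 0))
      with (Cminus (Cminus (lprod l z) (pterm (alt (esym l)) z 0))
                   (Cmult (Cmult (RtoC t) z) (lprod l z))).
    { apply is_Cseries_minus; [now apply is_Cseries_incr_1|now apply is_Cseries_scal]. }
    unfold pterm, alt; rewrite !esym_0; simpl; ring.
Qed.

Lemma ltheta_series l z : is_Cseries (pterm (ntimes (alt (esym l))) z) (ltheta l z).
Proof.
  induction l as [|t l IH].
  - eapply is_series_ext with (fun _ => RtoC 0); [|apply is_Cseries_0].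
    intros [|n]; unfold pterm, alt, ntimes.
    + change (INR 0) with 0; rewrite Rmult_0_l; symmetry; apply Cmult_0_l.
    + simpl esym; rewrite !Rmult_0_r; symmetry; apply Cmult_0_l.
  - apply is_Cseries_decr_1.
    eapply is_series_ext with
      (fun n => Cminus (Cminus (pterm (ntimes (alt (esym l))) z (S n))
                  (Cmult (Cmult (RtoC t) z) (pterm (ntimes (alt (esym l))) z n)))
                  (Cmult (Cmult (RtoC t) z) (pterm (alt (esym l)) z n))).
    { intros n; unfold pterm, alt, ntimes; rewrite esym_cons, Cpow_S, S_INR.
      rewrite !RtoC_mult, !RtoC_plus, RtoC_mult.
      replace (RtoC ((-1) ^ S n)) with (Copp (RtoC ((-1) ^ n))) by
        (rewrite <- RtoC_opp; f_equal; simpl; ring).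
      match goal with |- ?a = ?b => change (a = b :> C) end; ring. }
    replace (Cminus (ltheta (t :: l) z) (pterm (ntimes (alt (esym (t :: l)))) z 0))
      with (Cminus (Cminus (Cminus (ltheta l z) (pterm (ntimes (alt (esym l))) z 0))
                   (Cmult (Cmult (RtoC t) z) (ltheta l z)))
                   (Cmult (Cmult (RtoC t) z) (lprod l z))).
    { apply is_Cseries_minus; [apply is_Cseries_minus|].
      - now apply is_Cseries_incr_1.
      - now apply is_Cseries_scal.
      - apply is_Cseries_scal, lprod_series. }
    unfold pterm, alt, ntimes; rewrite !esym_0; simpl; rewrite !Rmult_0_l; ring.
Qed.

Lemma pterm_RtoC c x k : pterm c (RtoC x) k = RtoC (c k * x ^ k).
Proof. unfold pterm; now rewrite <- RtoC_pow, <- RtoC_mult. Qed.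

Lemma rprod_series l x : is_series (fun k => alt (esym l) k * x ^ k) (rprod l x).
Proof.
  assert (H := proj1 (is_series_C_parts _ _ (lprod_series l (RtoC x)))).
  rewrite lprod_RtoC in H.
  refine (is_series_ext _ _ _ _ H).
  intros n; now rewrite pterm_RtoC.
Qed.

Lemma rtheta_series l x : is_series (fun k => ntimes (alt (esym l)) k * x ^ k) (rtheta l x).
Proof.
  assert (H := proj1 (is_series_C_parts _ _ (ltheta_series l (RtoC x)))).
  rewrite ltheta_RtoC in H.
  refine (is_series_ext _ _ _ _ H).
  intros n; now rewrite pterm_RtoC.
Qed.

(** * Real polynomials: signs at and between roots, division, factorization *)

Definition peval (c : nat -> R) (n : nat) (x : R) : R := sum_n (fun k => c k * x ^ k) n.

Lemma peval_S c n x : peval c (S n) x = peval c n x + c (S n) * x ^ S n.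
Proof. unfold peval; now rewrite sum_Sn. Qed.

Lemma peval_stable c n m x :
  (forall k, (n < k)%nat -> c k = 0) -> (n <= m)%nat -> peval c m x = peval c n x.
Proof.
  intros H; induction 1 as [|m Hm IH]; [reflexivity|].
  rewrite peval_S, IH, H by lia; ring.
Qed.

Lemma peval_series c n x :
  (forall k, (n < k)%nat -> c k = 0) -> is_series (fun k => c k * x ^ k) (peval c n x).
Proof.
  intros H.
  apply (is_lim_seq_ext_loc (fun _ => peval c n x) _ (peval c n x)).
  - exists n; intros m Hm; symmetry; now apply (peval_stable c n m x).
  - apply is_lim_seq_const.
Qed.

Lemma peval_continuity c n : continuity (peval c n).
Proof.
  apply (derivable_continuous (peval c n)).
  induction n as [|n IH].
  - intros x. apply ex_derive_Reals_0. exists 0.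
    apply is_derive_ext with (fun _ => c 0%nat).
    + intros y; unfold peval; rewrite sum_O; simpl; symmetry; apply Rmult_1_r.
    + apply (is_derive_const (K := R_AbsRing) (V := R_NormedModule)).
  - intros x. apply ex_derive_Reals_0.
    apply ex_derive_ext with (fun y => peval c n y + c (S n) * y ^ S n).
    + intros y; symmetry; apply peval_S.
    + apply (ex_derive_plus (K := R_AbsRing) (V := R_NormedModule)).
      * apply ex_derive_Reals_1, IH.
      * auto_derive; trivial.
Qed.

Lemma pow_m1_sq k : (-1) ^ k * (-1) ^ k = 1.
Proof. rewrite <- Rpow_mult_distr; replace (-1 * -1) with 1 by ring; apply pow1. Qed.

Fixpoint inv_list (x : nat -> R) (n : nat) : list R :=
  match n with
  | O => nil
  | S m => / x m :: inv_list x m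
  end.

Lemma inv_list_in x n t : In t (inv_list x n) -> exists i, (i < n)%nat /\ t = / x i.
Proof.
  induction n as [|n IH]; simpl; [tauto|].
  intros [<-|H]; [now exists n; split; [lia|]|].
  destruct (IH H) as [i [Hi ->]]; exists i; split; [lia|easy].
Qed.

Lemma in_inv_list x n i : (i < n)%nat -> In (/ x i) (inv_list x n).
Proof.
  induction n as [|n IH]; [lia|]; intros H; simpl.
  destruct (Nat.eq_dec i n) as [->|]; [now left|right; apply IH; lia].
Qed.

(** The factor 1 - y/x_i is negative exactly for the k roots below y. *)
Lemma rprod_sign x n k y : 0 <= y ->
  (forall i, (i < k)%nat -> 0 < x i < y) ->
  (forall i, (k <= i < n)%nat -> y < x i) ->
  (k <= n)%nat -> 0 < (-1) ^ k * rprod (inv_list x n) y.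
Proof.
  intros Hy Hlt Hgt; induction n as [|n IH] in k, Hlt, Hgt |- *; intros Hk.
  - replace k with 0%nat by lia; simpl; lra.
  - destruct (Nat.eq_dec k (S n)) as [->|Hne].
    + assert (H : 0 < (-1) ^ n * rprod (inv_list x n) y).
      { apply IH; [intros; apply Hlt; lia|intros; lia|lia]. }
      destruct (Hlt n) as [H0 H1]; [lia|].
      simpl.
      replace (-1 * (-1) ^ n * ((1 - / x n * y) * rprod (inv_list x n) y))
        with (((y - x n) / x n) * ((-1) ^ n * rprod (inv_list x n) y)) by (field; lra).
      apply Rmult_lt_0_compat; [|exact H].
      apply Rdiv_lt_0_compat; lra.
    + assert (H : 0 < (-1) ^ k * rprod (inv_list x n) y).
      { apply IH; [intros; now apply Hlt|intros; apply Hgt; lia|lia]. }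
      assert (H1 : y < x n) by (apply Hgt; lia).
      simpl.
      replace ((-1) ^ k * ((1 - / x n * y) * rprod (inv_list x n) y))
        with (((x n - y) / x n) * ((-1) ^ k * rprod (inv_list x n) y)) by (field; lra).
      apply Rmult_lt_0_compat; [|exact H].
      apply Rdiv_lt_0_compat; lra.
Qed.

Lemma rprod_inv_root x n i : (i < n)%nat -> x i <> 0 -> rprod (inv_list x n) (x i) = 0.
Proof.
  intros Hi Hx; rewrite <- (Rinv_inv (x i)).
  apply rprod_root; [now apply in_inv_list|now apply Rinv_neq_0_compat].
Qed.

(** At the root x_i only one term of the product rule survives, namely minus the product of 1 -
    x_i/x_j over j <> i, and i of these factors are negative. *)
Lemma rtheta_sign x n i :
  (forall j, (j < n)%nat -> 0 < x j) ->
  (forall j k, (j < k < n)%nat -> x j < x k) ->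
  (i < n)%nat -> 0 < (-1) ^ S i * rtheta (inv_list x n) (x i).
Proof.
  induction n as [|n IH]; intros Hpos Hmono Hi; [lia|]; simpl rtheta.
  destruct (Nat.eq_dec i n) as [->|Hne].
  - assert (H : 0 < (-1) ^ n * rprod (inv_list x n) (x n)).
    { assert (0 < x n) by (apply Hpos; lia).
      apply rprod_sign; [lra| |intros; lia|lia].
      intros j Hj; split; [apply Hpos; lia|apply Hmono; lia]. }
    assert (0 < x n) by (apply Hpos; lia).
    rewrite Rinv_l by lra; simpl; lra.
  - assert (H : 0 < (-1) ^ S i * rtheta (inv_list x n) (x i)).
    { apply IH; [intros; apply Hpos; lia|intros; apply Hmono; lia|lia]. }
    assert (0 < x i) by (apply Hpos; lia).
    assert (x i < x n) by (apply Hmono; lia).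
    rewrite (rprod_inv_root x n i) by (try lia; lra).
    replace ((-1) ^ S i * ((1 - / x n * x i) * rtheta (inv_list x n) (x i) - / x n * x i * 0))
      with (((x n - x i) / x n) * ((-1) ^ S i * rtheta (inv_list x n) (x i)))
      by (field; lra).
    apply Rmult_lt_0_compat; [apply Rdiv_lt_0_compat; lra|exact H].
Qed.

(** Quotient of the power series [c] by 1 - x/r, computed from the constant term upwards. Its k-th
    coefficient times r^k is the k-th partial sum of [c] at r, so the quotient terminates exactly
    when r is a root. *)
Fixpoint divlin (c : nat -> R) (r : R) (k : nat) : R :=
  match k with
  | O => c 0%nat
  | S m => c (S m) + divlin c r m / r
  end.

Lemma divlin_peval c r k : r <> 0 -> divlin c r k * r ^ k = peval c k r.
Proof.
  intros Hr; induction k as [|k IH].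
  - unfold peval; rewrite sum_O; reflexivity.
  - rewrite peval_S, <- IH; simpl; field; exact Hr.
Qed.

Lemma peval_divlin c r n x : r <> 0 -> divlin c r (S n) = 0 ->
  peval c (S n) x = (1 - x / r) * peval (divlin c r) n x.
Proof.
  intros Hr H.
  assert (E : forall m, peval c (S m) x
            = (1 - x / r) * peval (divlin c r) m x + divlin c r (S m) * x ^ S m).
  { induction m as [|m IH].
    - unfold peval; rewrite sum_Sn, !sum_O; unfold plus; simpl; field; exact Hr.
    - rewrite peval_S, IH, (peval_S (divlin c r)).
      change (divlin c r (S (S m))) with (c (S (S m)) + divlin c r (S m) / r).
      change (x ^ S (S m)) with (x * x ^ S m); field; exact Hr. }
  rewrite E, H; ring.
Qed.

(** Induction dividing out the largest root; the other x_i remain roots of the quotient because 1 -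
    x_i/x_n does not vanish. *)
Lemma factorization n : forall (c x : nat -> R),
  c 0%nat = 1 -> (forall k, (n < k)%nat -> c k = 0) ->
  (forall i, (i < n)%nat -> 0 < x i /\ peval c n (x i) = 0) ->
  (forall i j, (i < j < n)%nat -> x i < x j) ->
  forall k, c k = alt (esym (inv_list x n)) k.
Proof.
  induction n as [|n IH]; intros c x H0 Hdeg Hroot Hmono k.
  - unfold alt; destruct k as [|k]; simpl; [lra|rewrite Hdeg by lia; ring].
  - destruct (Hroot n) as [Hxn Hn]; [lia|].
    assert (Hxn0 : x n <> 0) by lra.
    set (d := divlin c (x n)).
    assert (Hd0 : d (S n) = 0).
    { assert (E := divlin_peval c (x n) (S n) Hxn0).
      rewrite Hn in E; apply Rmult_integral in E as [E|E]; [exact E|].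
      exfalso; revert E; now apply pow_nonzero. }
    assert (Hd : forall k, d k = alt (esym (inv_list x n)) k).
    { apply IH.
      - exact H0.
      - intros m Hm; induction Hm as [|m Hm IHm]; [exact Hd0|].
        unfold d in *; simpl divlin; rewrite IHm, Hdeg by lia; field; exact Hxn0.
      - intros i Hi; destruct (Hroot i) as [Hxi Hi0]; [lia|]; split; [exact Hxi|].
        rewrite (peval_divlin c (x n) n (x i) Hxn0 Hd0) in Hi0.
        apply Rmult_integral in Hi0 as [E|E]; [|exact E].
        exfalso; assert (x i < x n) by (apply Hmono; lia).
        assert (x i / x n = 1) by lra.
        assert (x i = x i / x n * x n) by (field; lra). nra.
      - intros; apply Hmono; lia. }
    destruct k as [|k].
    + rewrite H0; unfold alt; rewrite esym_0; simpl; ring.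
    + assert (E : d (S k) = c (S k) + d k / x n) by reflexivity.
      rewrite !Hd in E; unfold alt in *; simpl inv_list; rewrite esym_cons.
      replace (c (S k)) with ((-1) ^ S k * esym (inv_list x n) (S k)
                              - (-1) ^ k * esym (inv_list x n) k / x n) by lra.
      simpl; field; exact Hxn0.
Qed.

(** Each of the n intervals between consecutive nodes contains a root, and n roots exhaust the
    degree. *)
Lemma sign_changes_factorization n (c y : nat -> R) :
  c 0%nat = 1 -> (forall k, (n < k)%nat -> c k = 0) ->
  0 <= y 0%nat -> (forall i, (i < n)%nat -> y i < y (S i)) ->
  (forall i, (i <= n)%nat -> 0 < (-1) ^ i * peval c n (y i)) ->
  exists x : nat -> R,
    (forall i, (i < n)%nat -> y i < x i < y (S i)) /\
    (forall i, (i < n)%nat -> 0 < x i) /\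
    (forall i j, (i < j < n)%nat -> x i < x j) /\
    (forall k, c k = alt (esym (inv_list x n)) k).
Proof.
  intros H0 Hdeg Hy0 Hy Hs.
  (* The informative existential makes the roots a function of the index; indices from [n] on
     receive the default value 0. *)
  assert (Hx : forall i, {z | (i < n)%nat -> y i < z < y (S i) /\ peval c n z = 0}).
  { intros i; destruct (Compare_dec.lt_dec i n) as [Hi|Hi]; [|exists 0; tauto].
    assert (S1 := Hs i); assert (S2 := Hs (S i)).
    assert (Hprod : peval c n (y i) * peval c n (y (S i)) < 0).
    { assert (P := Rmult_lt_0_compat _ _ (S1 ltac:(lia)) (S2 ltac:(lia))).
      replace ((-1) ^ i * peval c n (y i) * ((-1) ^ S i * peval c n (y (S i))))
        with (- ((-1) ^ i * (-1) ^ i) * (peval c n (y i) * peval c n (y (S i)))) in P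
        by (simpl; ring).
      rewrite pow_m1_sq in P; lra. }
    destruct (IVT_cor (peval c n) (y i) (y (S i)) (peval_continuity c n))
      as [z [Hz Hz0]]; [left; now apply Hy|lra|].
    exists z; intros _; split; [|exact Hz0].
    split; apply Rnot_le_lt; intros Hle.
    - replace z with (y i) in Hz0 by lra; rewrite Hz0 in Hprod; lra.
    - replace z with (y (S i)) in Hz0 by lra; rewrite Hz0 in Hprod; lra. }
  exists (fun i => proj1_sig (Hx i)).
  assert (Hx' : forall i, (i < n)%nat ->
            y i < proj1_sig (Hx i) < y (S i) /\ peval c n (proj1_sig (Hx i)) = 0)
    by (intros i; apply (proj2_sig (Hx i))).
  assert (Hyle : forall i j, (i <= j <= n)%nat -> y i <= y j).
  { intros i j [Hij Hj]; induction Hij as [|j Hij IHj]; [lra|].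
    assert (y j < y (S j)) by (apply Hy; lia).
    assert (y i <= y j) by (apply IHj; lia). lra. }
  assert (Hpos : forall i, (i < n)%nat -> 0 < proj1_sig (Hx i)).
  { intros i Hi; assert (y 0%nat <= y i) by (apply Hyle; lia).
    destruct (Hx' i Hi); lra. }
  assert (Hmono : forall i j, (i < j < n)%nat -> proj1_sig (Hx i) < proj1_sig (Hx j)).
  { intros i j Hij; assert (y (S i) <= y j) by (apply Hyle; lia).
    destruct (Hx' i ltac:(lia)); destruct (Hx' j ltac:(lia)); lra. }
  repeat split.
  - now apply Hx'.
  - now apply Hx'.
  - exact Hpos.
  - exact Hmono.
  - apply factorization; try assumption.
    intros i Hi; split; [now apply Hpos|now apply Hx'].
Qed.

(** * Wall polynomials *)

Lemma qpoch_shift a q k : qpoch a q (S k) = (1 - a) * qpoch (a * q) q k.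
Proof.
  induction k as [|k IH]; [simpl; ring|].
  change (qpoch a q (S k) * (1 - a * q ^ S k)
          = (1 - a) * (qpoch (a * q) q k * (1 - a * q * q ^ k))).
  rewrite IH; simpl; ring.
Qed.

Lemma pow_lt_1 q k : 0 < q < 1 -> 0 < q ^ k <= 1.
Proof.
  intros Hq; split; [now apply pow_lt|].
  rewrite <- (pow1 k); apply pow_incr; lra.
Qed.

Lemma qpoch_factor_pos a q k : 0 < q < 1 -> 0 < a < 1 -> 0 < 1 - a * q ^ k.
Proof. intros Hq Ha; assert (H := pow_lt_1 q k Hq); nra. Qed.

Lemma qpoch_pos a q k : 0 < q < 1 -> 0 < a < 1 -> 0 < qpoch a q k.
Proof.
  intros Hq Ha; induction k as [|k IH]; simpl; [lra|].
  apply Rmult_lt_0_compat; [exact IH|now apply qpoch_factor_pos].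
Qed.

Lemma qpoch_inv_pow_vanish q n k : 0 < q -> (n < k)%nat -> qpoch (/ q ^ n) q k = 0.
Proof.
  intros Hq; induction 1 as [|k Hk IH]; simpl.
  - rewrite Rinv_l by (apply pow_nonzero; lra); ring.
  - rewrite IH; ring.
Qed.

(** The identity between coefficients, multiplied by x^(k+1) and summed; the constant terms
    cancel. *)
Lemma peval_recurrence (u v w : nat -> R) A B x :
  u 0%nat = v 0%nat -> w 0%nat = v 0%nat ->
  (forall k, A * (u (S k) - v (S k)) - B * (v (S k) - w (S k)) = - v k) ->
  forall m, A * (peval u (S m) x - peval v (S m) x)
            - B * (peval v (S m) x - peval w (S m) x) = - (x * peval v m x).
Proof.
  intros Hu Hw H; induction m as [|m IH].
  - rewrite !peval_S; unfold peval; rewrite !sum_O, Hu, Hw.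
    transitivity (x * (A * (u 1%nat - v 1%nat) - B * (v 1%nat - w 1%nat))).
    + simpl; ring.
    + rewrite H; simpl; ring.
  - rewrite !(peval_S _ (S m)), (peval_S v m x).
    replace (- (x * (peval v m x + v (S m) * x ^ S m)))
      with (- (x * peval v m x) + x ^ S (S m) * - v (S m)) by (simpl; ring).
    rewrite <- IH, <- H, !(peval_S _ m); ring.
Qed.

(* Coefficients of the Wall (little q-Laguerre) polynomial
   [2phi1(q^(-n), 0; c; q; q x)]. *)
Definition wall (q c : R) (n k : nat) : R :=
  q ^ k * qpoch (/ q ^ n) q k / (qpoch q q k * qpoch c q k).

Section Wall.

Variables q c : R.
Hypothesis Hq : 0 < q < 1.
Hypothesis Hc : 0 < c < 1.

Lemma wall_0 n : wall q c n 0 = 1.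
Proof. unfold wall; simpl; field. Qed.

Lemma wall_vanish n k : (n < k)%nat -> wall q c n k = 0.
Proof.
  intros H; unfold wall; rewrite qpoch_inv_pow_vanish by (try lra; lia).
  unfold Rdiv; ring.
Qed.

(** Three-term recurrence compared at x^(k+1). With a = q^(-n-1) the numerators are (a/q;q)_(k+1),
    (a;q)_(k+1), (aq;q)_(k+1) and (a;q)_k, all rational multiples of (a;q)_k, so that a rational
    identity remains. *)
Lemma wall_recurrence n k :
  let Q := q ^ S n in
  Q * (1 - c * Q) * (wall q c (S (S n)) (S k) - wall q c (S n) (S k))
  - c / q * Q * (1 - Q) * (wall q c (S n) (S k) - wall q c n (S k))
  = - wall q c (S n) k.
Proof.
  intros Q; unfold wall.
  assert (HQ : 0 < Q) by (apply pow_lt; lra).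
  assert (HQ1 : Q < 1) by (apply pow_lt_1_compat; [lra|lia]).
  set (a := / Q).
  assert (Ha : 1 < a).
  { unfold a; rewrite <- Rinv_1; apply Rinv_lt_contravar; lra. }
  replace (/ q ^ S (S n)) with (a / q) by
    (unfold a, Q; simpl; field; repeat split; (lra || (apply pow_nonzero; lra))).
  replace (/ q ^ n) with (a * q) by
    (unfold a, Q; simpl; field; repeat split; (lra || (apply pow_nonzero; lra))).
  change (/ q ^ S n) with a.
  rewrite (qpoch_shift (a / q)).
  replace (a / q * q) with a by (field; lra).
  assert (E : (1 - a) * qpoch (a * q) q k = qpoch a q k * (1 - a * q ^ k)).
  { rewrite <- qpoch_shift; reflexivity. }
  assert (EX : qpoch (a * q) q k = qpoch a q k * (1 - a * q ^ k) / (1 - a)).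
  { rewrite <- E; field; lra. }
  cbn [qpoch]; rewrite EX.
  assert (Pq : qpoch q q k <> 0) by (apply Rgt_not_eq; now apply qpoch_pos).
  assert (Pc : qpoch c q k <> 0) by (apply Rgt_not_eq; now apply qpoch_pos).
  assert (Fq : 1 - q * q ^ k <> 0) by (apply Rgt_not_eq; now apply qpoch_factor_pos).
  assert (Fc : 1 - c * q ^ k <> 0) by (apply Rgt_not_eq; now apply qpoch_factor_pos).
  replace Q with (/ a) by (unfold a; now rewrite Rinv_inv).
  simpl; field.
  repeat split; trivial; lra.
Qed.

Lemma wall_peval_recurrence n x :
  let Q := q ^ S n in
  Q * (1 - c * Q) * (peval (wall q c (S (S n))) (S (S n)) x - peval (wall q c (S n)) (S n) x)
  - c / q * Q * (1 - Q) * (peval (wall q c (S n)) (S n) x - peval (wall q c n) n x)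
  = - (x * peval (wall q c (S n)) (S n) x).
Proof.
  intros Q.
  rewrite <- (peval_stable (wall q c n) n (S (S n)) x) by (lia || apply wall_vanish).
  rewrite <- (peval_recurrence (wall q c (S (S n))) (wall q c (S n)) (wall q c n)
                (Q * (1 - c * Q)) (c / q * Q * (1 - Q)) x).
  - rewrite (peval_stable (wall q c (S n)) (S n) (S (S n)) x) by (lia || apply wall_vanish).
    reflexivity.
  - now rewrite !wall_0.
  - now rewrite !wall_0.
  - intros k; apply wall_recurrence.
Qed.

(** Recursive form of the q-Chu-Vandermonde value p_n(1) = (-c)^n q^(n(n-1)/2) / (c;q)_n, obtained
    here from the recurrence at x = 1. Its sign supplies the last sign change in the Sturm
    argument. *)
Lemma wall_at_1 n :
  peval (wall q c (S n)) (S n) 1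
  = - (c * q ^ n / (1 - c * q ^ n)) * peval (wall q c n) n 1.
Proof.
  induction n as [|n IH].
  - unfold peval; rewrite sum_Sn, !sum_O, !wall_0; unfold plus, wall; simpl.
    field; split; lra.
  - assert (R := wall_peval_recurrence n 1); cbv zeta in R.
    assert (H1 := qpoch_factor_pos c q (S n) Hq Hc).
    assert (H0 := qpoch_factor_pos c q n Hq Hc).
    assert (HQ : 0 < q ^ n) by (apply pow_lt; lra).
    set (p2 := peval (wall q c (S (S n))) (S (S n)) 1) in *.
    set (p1 := peval (wall q c (S n)) (S n) 1) in *.
    set (p0 := peval (wall q c n) n 1) in *.
    simpl in R, H1 |- *; set (Q := q ^ n) in *.
    assert (E0 : p0 = - ((1 - c * Q) / (c * Q)) * p1) by (rewrite IH; field; lra).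
    rewrite E0 in R; clear IH E0 p0.
    apply (Rmult_eq_reg_l (q * Q * (1 - c * (q * Q)))).
    2: { apply Rmult_integral_contrapositive_currified; [|lra].
         apply Rmult_integral_contrapositive_currified; lra. }
    match type of R with ?a * (p2 - p1) - ?b = ?r =>
      replace (a * p2) with (a * p1 + b + r) by lra end.
    field; lra.
Qed.

Lemma wall_at_1_sign n : 0 < (-1) ^ n * peval (wall q c n) n 1.
Proof.
  induction n as [|n IH].
  - unfold peval; rewrite sum_O, wall_0; simpl; lra.
  - rewrite wall_at_1.
    assert (0 < q ^ n) by (apply pow_lt; lra).
    replace ((-1) ^ S n * (- (c * q ^ n / (1 - c * q ^ n)) * peval (wall q c n) n 1))
      with (c * q ^ n / (1 - c * q ^ n) * ((-1) ^ n * peval (wall q c n) n 1))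
      by (simpl; ring).
    apply Rmult_lt_0_compat; [|exact IH].
    apply Rdiv_lt_0_compat; [apply Rmult_lt_0_compat; lra|now apply qpoch_factor_pos].
Qed.

Lemma peval_0 (f : nat -> R) n : peval f n 0 = f 0%nat.
Proof.
  induction n as [|n IH]; [unfold peval; rewrite sum_O; simpl; ring|].
  rewrite peval_S, IH; simpl; ring.
Qed.

Lemma peval_factored (f : nat -> R) n l x :
  (forall k, (n < k)%nat -> f k = 0) -> (forall k, f k = alt (esym l) k) ->
  peval f n x = rprod l x.
Proof.
  intros Hv Hf.
  rewrite <- (is_series_unique _ _ (peval_series f n x Hv)).
  rewrite <- (is_series_unique _ _ (rprod_series l x)).
  apply Series_ext; intros k; now rewrite Hf.
Qed.

(* Sturm argument: at a root of [p_n] the recurrence gives [p_(n+1)] the sign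
   opposite to [p_(n-1)], so the roots of [p_n], together with 0 and 1, separate
   those of [p_(n+1)]. *)
Lemma wall_roots n : exists x : nat -> R,
  (forall i, (i < n)%nat -> 0 < x i < 1) /\
  (forall i j, (i < j < n)%nat -> x i < x j) /\
  (forall k, wall q c n k = alt (esym (inv_list x n)) k) /\
  (forall i, (i < n)%nat -> 0 < (-1) ^ i * peval (wall q c (pred n)) (pred n) (x i)).
Proof.
  (* The last conjunct is the interlacing invariant: it records the sign of p_(n-1) at the roots of
     p_n, which is what the recurrence at such a root consumes. *)
  induction n as [|n (x & Hx & Hmono & Hfact & Hsign)].
  - exists (fun _ => 0); repeat split; try (intros; lia).
    intros [|k]; [rewrite wall_0; unfold alt; simpl; lra|].
    rewrite wall_vanish by lia; unfold alt; simpl; ring.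
  - set (y := fun i => match i with
                       | O => 0
                       | S j => if Compare_dec.lt_dec j n then x j else 1
                       end).
    assert (Hyx : forall i, (i < n)%nat -> y (S i) = x i).
    { intros i Hi; unfold y; destruct (Compare_dec.lt_dec i n); [easy|lia]. }
    assert (Hy1 : y (S n) = 1).
    { unfold y; destruct (Compare_dec.lt_dec n n); [lia|easy]. }
    assert (Hpn : forall z, peval (wall q c n) n z = rprod (inv_list x n) z).
    { intros z; apply peval_factored; [apply wall_vanish|exact Hfact]. }
    destruct (sign_changes_factorization (S n) (wall q c (S n)) y)
      as (x' & Hb & Hpos & Hmono' & Hfact').
    + apply wall_0.
    + apply wall_vanish.
    + simpl; lra.
    + intros i Hi; destruct (Nat.eq_dec i n) as [->|Hne].
      * rewrite Hy1; destruct n as [|m]; [simpl; lra|].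
        rewrite Hyx by lia; apply Hx; lia.
      * rewrite (Hyx i) by lia; destruct i as [|i]; [apply Hx; lia|].
        rewrite Hyx by lia; apply Hmono; lia.
    + intros [|i] Hi; [simpl y; rewrite peval_0, wall_0; simpl; lra|].
      destruct (Nat.eq_dec i n) as [->|Hne]; [rewrite Hy1; apply wall_at_1_sign|].
      rewrite Hyx by lia.
      destruct n as [|m]; [lia|].
      assert (R := wall_peval_recurrence m (x i)); cbv zeta in R.
      assert (Hroot : peval (wall q c (S m)) (S m) (x i) = 0).
      { rewrite Hpn; apply rprod_inv_root; [lia|].
        assert (0 < x i < 1) by (apply Hx; lia); lra. }
      specialize (Hsign i ltac:(lia)); simpl pred in Hsign.
      assert (HQ : 0 < q ^ S m) by (apply pow_lt; lra).
      assert (HQ1 : q ^ S m < 1) by (apply pow_lt_1_compat; [lra|lia]).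
      assert (HcQ := qpoch_factor_pos c q (S m) Hq Hc).
      rewrite Hroot in R.
      set (p2 := peval (wall q c (S (S m))) (S (S m)) (x i)) in *.
      set (p0 := peval (wall q c m) m (x i)) in *.
      set (Q := q ^ S m) in *.
      assert (HA : 0 < Q * (1 - c * Q)) by (apply Rmult_lt_0_compat; lra).
      assert (HC : 0 < c / q * Q * (1 - Q)).
      { apply Rmult_lt_0_compat; [apply Rmult_lt_0_compat|]; [apply Rdiv_lt_0_compat| |]; lra. }
      apply (Rmult_lt_reg_l (Q * (1 - c * Q))); [exact HA|].
      replace (Q * (1 - c * Q) * ((-1) ^ S i * p2))
        with (c / q * Q * (1 - Q) * ((-1) ^ i * p0)).
      * rewrite Rmult_0_r; now apply Rmult_lt_0_compat.
      * transitivity ((-1) ^ S i * (- (c / q * Q * (1 - Q) * p0))).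
        { simpl; ring. }
        replace (- (c / q * Q * (1 - Q) * p0)) with (Q * (1 - c * Q) * p2) by lra.
        ring.
    + assert (Hx'x : forall i j, (i <= j < n)%nat -> x' i < x j).
      { intros i j Hij.
        assert (H1 := proj2 (Hb i ltac:(lia))); rewrite Hyx in H1 by lia.
        destruct (Nat.eq_dec i j) as [->|]; [exact H1|].
        assert (x i < x j) by (apply Hmono; lia); lra. }
      assert (Hxx' : forall i j, (i < j <= n)%nat -> x i < x' j).
      { intros i j Hij; destruct j as [|j]; [lia|].
        assert (H1 := proj1 (Hb (S j) ltac:(lia))); rewrite Hyx in H1 by lia.
        destruct (Nat.eq_dec i j) as [->|]; [exact H1|].
        assert (x i < x j) by (apply Hmono; lia); lra. }
      exists x'; repeat split.
      * now apply Hpos.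
      * destruct (Nat.eq_dec i n) as [->|].
        { rewrite <- Hy1; now apply Hb. }
        assert (x' i < x i) by (apply Hx'x; lia).
        assert (0 < x i < 1) by (apply Hx; lia); lra.
      * exact Hmono'.
      * exact Hfact'.
      (* Exactly the first i roots of p_n lie below the i-th root of p_(n+1), which restores the
         invariant. *)
      * intros i Hi; simpl pred; rewrite Hpn.
        apply rprod_sign; [left; now apply Hpos| | |lia].
        { intros j Hj; split; [apply Hx; lia|apply Hxx'; lia]. }
        { intros j Hj; apply Hx'x; lia. }
Qed.

Definition odd_weight (f : nat -> R) (k : nat) : R := (2 * INR k + 1) * f k.

(* [odd_weight] on coefficients is the operator [P -> P + 2 x P']; its value at
   the roots of [P] alternates in sign. *)
Lemma wall_roots_pair n : exists x x' : nat -> R,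
  (forall i, (i < n)%nat -> 0 < x' i < x i) /\
  (forall k, wall q c n k = alt (esym (inv_list x n)) k) /\
  (forall k, odd_weight (wall q c n) k = alt (esym (inv_list x' n)) k).
Proof.
  destruct (wall_roots n) as (x & Hx & Hmono & Hfact & _).
  (* With nodes 0, x_0, ..., x_(n-1), the i-th new root lies just below x_i, whence x'_i < x_i. *)
  set (y := fun i => match i with O => 0 | S j => x j end).
  assert (Hvan : forall k, (n < k)%nat -> odd_weight (wall q c n) k = 0).
  { intros k Hk; unfold odd_weight; rewrite wall_vanish by exact Hk; ring. }
  assert (Hev : forall z, peval (odd_weight (wall q c n)) n z
            = rprod (inv_list x n) z + 2 * rtheta (inv_list x n) z).
  { intros z; rewrite <- (is_series_unique _ _ (peval_series _ n z Hvan)).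
    apply is_series_unique.
    assert (H1 := rprod_series (inv_list x n) z).
    assert (H2 := is_series_scal 2 _ _ (rtheta_series (inv_list x n) z)).
    assert (H3 := is_series_plus _ _ _ _ H1 H2).
    refine (is_series_ext _ _ _ _ H3); intros k.
    unfold odd_weight, ntimes; rewrite Hfact.
    unfold plus, scal; simpl; unfold mult; simpl; ring. }
  destruct (sign_changes_factorization n (odd_weight (wall q c n)) y)
    as (x' & Hb & Hpos & _ & Hfact').
  - unfold odd_weight; rewrite wall_0; simpl; ring.
  - exact Hvan.
  - simpl; lra.
  - intros [|i] Hi; simpl; [apply Hx; lia|apply Hmono; lia].
  - intros [|i] Hi.
    + simpl y; rewrite peval_0; unfold odd_weight; rewrite wall_0; simpl; lra.
    + simpl y; rewrite Hev, rprod_inv_root; [|lia|].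
      * assert (H := rtheta_sign x n i (fun j h => proj1 (Hx j h)) Hmono ltac:(lia)); lra.
      * assert (0 < x i < 1) by (apply Hx; lia); lra.
  - exists x, x'; repeat split; try assumption.
    + now apply Hpos.
    + exact (proj2 (Hb i H)).
Qed.

End Wall.

(** * Dominated convergence and entire coefficient sequences *)

Lemma ex_series_Rle (a b : nat -> R) :
  (forall k, Rabs (a k) <= b k) -> ex_series b -> ex_series a.
Proof. intros H; exact (@ex_series_le R_AbsRing R_CompleteNormedModule a b H). Qed.

Lemma is_lim_seq_0_abs_le (u v : nat -> R) :
  (forall n, Rabs (u n) <= v n) -> is_lim_seq v 0 -> is_lim_seq u 0.
Proof.
  intros H Hv; apply is_lim_seq_abs_0.
  apply is_lim_seq_le_le with (fun _ => 0) v; [|apply is_lim_seq_const|exact Hv].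
  intros n; split; [apply Rabs_pos|apply H].
Qed.

Lemma eventually_lt (u : nat -> R) (l b : R) :
  is_lim_seq u l -> l < b -> eventually (fun n => u n < b).
Proof.
  intros H Hb; apply is_lim_seq_spec in H.
  destruct (H (mkposreal (b - l) ltac:(lra))) as [N HN]; exists N; intros n Hn.
  specialize (HN n Hn); simpl in HN; apply Rabs_def2 in HN; lra.
Qed.

Lemma is_lim_seq_ge_eventually (u : nat -> R) (l b : R) :
  is_lim_seq u l -> eventually (fun n => b <= u n) -> b <= l.
Proof.
  intros H Hb; apply Rnot_lt_le; intros Hlt.
  destruct (filter_and _ _ Hb (eventually_lt u l b H Hlt)) as [N HN].
  destruct (HN N (Nat.le_refl N)); lra.
Qed.

Lemma Series_ge0 (a : nat -> R) : (forall k, 0 <= a k) -> ex_series a -> 0 <= Series a.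
Proof.
  intros H Ha; rewrite <- (is_series_unique (fun _ => 0) 0).
  - apply Series_le; [intros k; split; [lra|apply H]|exact Ha].
  - apply (is_lim_seq_ext (fun _ => 0) _ 0); [|apply is_lim_seq_const].
    intros n; rewrite sum_n_const; ring.
Qed.

Section Tannery.

Variables (u : nat -> nat -> R) (a v : nat -> R).
Hypothesis Hv : ex_series v.
Hypothesis Hu : forall N k, Rabs (u N k) <= v k.
Hypothesis Ha : forall k, is_lim_seq (fun N => u N k) (a k).

Lemma tannery_limit_le k : Rabs (a k) <= v k.
Proof.
  apply (is_lim_seq_le (fun N => Rabs (u N k)) (fun _ => v k) (Rabs (a k)) (v k)).
  - intros n; apply Hu.
  - apply (is_lim_seq_abs _ (a k)), Ha.
  - apply is_lim_seq_const.
Qed.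

Lemma tannery_diff_le N k : Rabs (u N k - a k) <= 2 * v k.
Proof.
  assert (H1 := Hu N k); assert (H2 := tannery_limit_le k).
  unfold Rminus; eapply Rle_trans; [apply Rabs_triang|]; rewrite Rabs_Ropp; lra.
Qed.

Lemma ex_series_2v : ex_series (fun k => 2 * v k).
Proof. exact (ex_series_scal 2 v Hv). Qed.

Lemma tannery_ex_diff N : ex_series (fun k => Rabs (u N k - a k)).
Proof.
  apply ex_series_Rle with (fun k => 2 * v k); [|apply ex_series_2v].
  intros k; rewrite Rabs_Rabsolu; apply tannery_diff_le.
Qed.

(** The head is a finite sum of null sequences and the tail is at most that of 2 v. The form with
    absolute values inside the sum is needed later: for power series it gives convergence uniform on
    [0, x] from the single point x. *)
Lemma tannery_abs : is_lim_seq (fun N => Series (fun k => Rabs (u N k - a k))) 0.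
Proof.
  assert (Hhead : forall m,
    is_lim_seq (fun N => sum_f_R0 (fun k => Rabs (u N k - a k)) m) 0).
  { assert (Hk : forall k, is_lim_seq (fun N => Rabs (u N k - a k)) 0).
    { intros k; rewrite <- Rabs_R0, <- (Rminus_diag (a k)).
      apply (is_lim_seq_abs _ (a k - a k)), is_lim_seq_minus'; [apply Ha|].
      apply is_lim_seq_const. }
    induction m as [|m IH]; [apply Hk|].
    simpl; rewrite <- (Rplus_0_l 0); now apply is_lim_seq_plus'. }
  apply is_lim_seq_spec; intros eps.
  assert (Hsum := Series_correct _ ex_series_2v).
  assert (Hsum' : is_lim_seq (sum_n (fun k => 2 * v k)) (Series (fun k => 2 * v k)))
    by exact Hsum.
  apply is_lim_seq_spec in Hsum'.
  (* The cut m leaves a tail of 2 v below eps/2; the head is then made smaller than eps/2 by taking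
     N large. *)
  destruct (Hsum' (pos_div_2 eps)) as [m Hm].
  specialize (Hm m (Nat.le_refl m)); rewrite sum_n_Reals in Hm.
  rewrite (Series_incr_n (fun k => 2 * v k) (S m)) in Hm by (lia || apply ex_series_2v).
  apply Rabs_def2 in Hm; simpl pred in Hm.
  destruct (eventually_lt _ 0 (pos_div_2 eps) (Hhead m) (cond_pos _)) as [N0 HN].
  exists N0; intros N HN0; specialize (HN N HN0).
  rewrite (Series_incr_n _ (S m)) by (lia || apply tannery_ex_diff); simpl pred.
  assert (Htail : Series (fun k => Rabs (u N (S m + k)%nat - a (S m + k)%nat))
            <= Series (fun k => 2 * v (S m + k)%nat)).
  { apply Series_le.
    - intros k; split; [apply Rabs_pos|apply tannery_diff_le].
    - apply (ex_series_incr_n (fun k => 2 * v k) (S m)), ex_series_2v. }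
  assert (Htail0 : 0 <= Series (fun k => Rabs (u N (S m + k)%nat - a (S m + k)%nat))).
  { apply Series_ge0; [intros k; apply Rabs_pos|].
    apply (ex_series_incr_n (fun k => Rabs (u N k - a k)) (S m)), tannery_ex_diff. }
  assert (Hhead0 : 0 <= sum_f_R0 (fun k => Rabs (u N k - a k)) m)
    by (apply cond_pos_sum; intros; apply Rabs_pos).
  rewrite Rminus_0_r, Rabs_pos_eq by lra.
  simpl in *; lra.
Qed.

Lemma tannery : is_lim_seq (fun N => Series (u N)) (Series a).
Proof.
  assert (HuN : forall N, ex_series (u N)) by
    (intros N; apply ex_series_Rle with v; [apply Hu|exact Hv]).
  assert (Hea : ex_series a) by
    (apply ex_series_Rle with v; [apply tannery_limit_le|exact Hv]).
  assert (H : is_lim_seq (fun N => Series (u N) - Series a) 0).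
  { eapply is_lim_seq_0_abs_le; [|apply tannery_abs].
    intros N; cbv beta; rewrite <- Series_minus by easy.
    apply (Series_Rabs (fun k => u N k - a k)), tannery_ex_diff. }
  assert (H' := is_lim_seq_plus' _ _ _ _ H (is_lim_seq_const (Series a))).
  rewrite Rplus_0_l in H'.
  apply is_lim_seq_ext with (2 := H'); intros; ring.
Qed.

End Tannery.

Section EntireCoefficients.

Variable e : nat -> R.
Hypothesis Hpos : forall k, 0 < e k.
Hypothesis Hratio : is_lim_seq (fun k => INR (S k) * (e (S k) / e k)) 0.

Lemma ratio_lim_0 : is_lim_seq (fun k => e (S k) / e k) 0.
Proof.
  eapply is_lim_seq_0_abs_le; [|exact Hratio].
  intros k; cbv beta.
  assert (H : 0 < e (S k) / e k) by (apply Rdiv_lt_0_compat; apply Hpos).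
  rewrite Rabs_pos_eq by lra.
  rewrite <- (Rmult_1_l (e (S k) / e k)) at 1; apply Rmult_le_compat_r; [lra|].
  rewrite S_INR; assert (0 <= INR k) by apply pos_INR; lra.
Qed.

Lemma CV_radius_alt : CV_radius (alt e) = p_infty.
Proof.
  assert (H0 : forall n, (-1) ^ n <> 0) by (intros; apply pow_nonzero; lra).
  apply CV_radius_infinite_DAlembert.
  - intros n; apply Rmult_integral_contrapositive_currified; [apply H0|].
    apply Rgt_not_eq, Hpos.
  - apply is_lim_seq_ext with (2 := ratio_lim_0).
    intros n; unfold alt.
    replace ((-1) ^ S n * e (S n) / ((-1) ^ n * e n)) with (- (e (S n) / e n)).
    + rewrite Rabs_Ropp, Rabs_pos_eq; [reflexivity|].
      left; apply Rdiv_lt_0_compat; apply Hpos.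
    + simpl; field; split; [apply Rgt_not_eq, Hpos|apply H0].
Qed.

Lemma ex_series_entire x : ex_series (fun k => e k * x ^ k).
Proof.
  apply ex_pseries_R, CV_radius_inside.
  rewrite CV_radius_infinite_DAlembert; [exact I| |].
  - intros n; apply Rgt_not_eq, Hpos.
  - apply is_lim_seq_ext with (2 := ratio_lim_0).
    intros n; rewrite Rabs_pos_eq; [reflexivity|].
    left; apply Rdiv_lt_0_compat; apply Hpos.
Qed.

Lemma PSeries_alt_continuity : continuity (PSeries (alt e)).
Proof. intros x; apply PSeries_continuity; rewrite CV_radius_alt; exact I. Qed.

(** Vanishing defects occur for (1 - g x)^m exp(-a x). The factor [INR (S k)] in [Hratio] excludes
    the exponential, whose coefficients a^k/k! have (k+1) e_(k+1)/e_k = a; positivity of all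
    coefficients excludes the polynomial. *)
Lemma newton_defect_nonzero p1 p2 g :
  0 < g -> (forall n, newton_defect e p1 p2 g n = 0) -> False.
Proof.
  intros Hg H.
  set (rho := fun k => INR (S k) * (e (S k) / e k)) in *.
  (* After division by e_(n+1) every term tends to 0 except the constant g p1 - p2. *)
  assert (E : g * p1 = p2).
  { assert (HS : forall m, is_lim_seq (fun n => rho (n + m)%nat) 0)
      by (intros m; now apply (is_lim_seq_incr_n rho m)).
    assert (HR := proj1 (is_lim_seq_incr_n _ 1 0) ratio_lim_0).
    assert (Hlim : is_lim_seq (fun n => rho (n + 2)%nat * (e (S (n + 1)) / e (n + 1)%nat)
              + g * rho (n + 1)%nat - p1 * (e (S (n + 1)) / e (n + 1)%nat))
              (0 * 0 + g * 0 - p1 * 0)).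
    { apply is_lim_seq_minus'; [apply is_lim_seq_plus'|].
      - apply is_lim_seq_mult'; [apply HS|exact HR].
      - apply is_lim_seq_mult'; [apply is_lim_seq_const|apply HS].
      - apply is_lim_seq_mult'; [apply is_lim_seq_const|exact HR]. }
    assert (Hc : is_lim_seq (fun _ => g * p1 - p2) (g * p1 - p2)) by apply is_lim_seq_const.
    assert (Heq : forall n, rho (n + 2)%nat * (e (S (n + 1)) / e (n + 1)%nat)
              + g * rho (n + 1)%nat - p1 * (e (S (n + 1)) / e (n + 1)%nat) = g * p1 - p2).
    { intros n; specialize (H n); unfold newton_defect in H; unfold rho.
      replace (S (n + 2))%nat with (n + 3)%nat by lia.
      replace (S (n + 1))%nat with (n + 2)%nat by lia.
      assert (H1 := Hpos (n + 1)%nat); assert (H2 := Hpos (n + 2)%nat).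
      apply (Rmult_eq_reg_r (e (n + 1)%nat)); [|lra].
      match goal with |- ?l = _ =>
        replace l with (INR (n + 3) * e (n + 3)%nat
          + g * (INR (n + 2) * e (n + 2)%nat) - p1 * e (n + 2)%nat) by (field; lra) end.
      lra. }
    apply (is_lim_seq_ext _ _ _ Heq) in Hlim.
    apply is_lim_seq_unique in Hlim; apply is_lim_seq_unique in Hc.
    rewrite Hc in Hlim; injection Hlim; lra. }
  (* The relation is now p1 e_(N+2) = (N+3) e_(N+3) + g (N+2) e_(N+2), impossible for positive
     coefficients once g N exceeds p1. *)
  destruct (archimed_cor1 (g / (1 + Rabs p1))) as [N [HN HN0]].
  { apply Rdiv_lt_0_compat; [lra|]; assert (0 <= Rabs p1) by apply Rabs_pos; lra. }
  specialize (H N); unfold newton_defect in H; subst p2.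
  assert (H2 := Hpos (N + 2)%nat); assert (H3 := Hpos (N + 3)%nat).
  assert (HI : 0 < INR N) by (apply lt_0_INR; lia).
  assert (Hp := Rabs_pos p1); assert (Hp' := Rle_abs p1).
  assert (HgN : 1 + Rabs p1 < g * INR N).
  { apply (Rmult_lt_compat_r (INR N * (1 + Rabs p1))) in HN; [|apply Rmult_lt_0_compat; lra].
    replace (/ INR N * (INR N * (1 + Rabs p1))) with (1 + Rabs p1) in HN by (field; lra).
    replace (g / (1 + Rabs p1) * (INR N * (1 + Rabs p1))) with (g * INR N) in HN
      by (field; lra).
    exact HN. }
  assert (HN3 : 0 < INR (N + 3) * e (N + 3)%nat).
  { apply Rmult_lt_0_compat; [apply lt_0_INR; lia|exact H3]. }
  rewrite (plus_INR N 2) in H; simpl (INR 2) in H.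
  assert (0 < (g * (INR N + (1 + 1)) - p1) * e (N + 2)%nat)
    by (apply Rmult_lt_0_compat; [nra|lra]).
  lra.
Qed.

End EntireCoefficients.

(** * Euler-Rayleigh inequalities *)

Section RealRootedLimit.

Variables (L : nat -> list R) (e : nat -> R).
Hypothesis HL : forall N t, In t (L N) -> 0 < t.
Hypothesis He : forall k, 0 < e k.
Hypothesis He0 : e 0%nat = 1.
Hypothesis Hle : forall N k, esym (L N) k <= e k.
Hypothesis Hlim : forall k, is_lim_seq (fun N => esym (L N) k) (e k).
Hypothesis Hratio : is_lim_seq (fun k => INR (S k) * (e (S k) / e k)) 0.

Let psi := PSeries (alt e).
Let p1 := e 1%nat.
(** Like [p3], given by Newton's identity and not as a sum over roots of [psi]; the link with roots
    passes through the lists [L N]. *)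
Let p2 := e 1%nat ^ 2 - 2 * e 2%nat.
Let p3 := e 1%nat ^ 3 - 3 * e 1%nat * e 2%nat + 3 * e 3%nat.

Lemma psi_0 : psi 0 = 1.
Proof. unfold psi; rewrite PSeries_0; unfold alt; simpl; rewrite He0; ring. Qed.

Lemma psum_1_lim : is_lim_seq (fun N => psum (L N) 1) p1.
Proof. apply is_lim_seq_ext with (2 := Hlim 1%nat); intros N; symmetry; apply psum_1. Qed.

Lemma psum_2_lim : is_lim_seq (fun N => psum (L N) 2) p2.
Proof.
  assert (H : is_lim_seq (fun N => esym (L N) 1 * esym (L N) 1 - 2 * esym (L N) 2)
                         (p1 * p1 - 2 * e 2%nat)).
  { apply is_lim_seq_minus'.
    - apply is_lim_seq_mult'; apply Hlim.
    - apply is_lim_seq_mult'; [apply is_lim_seq_const|apply Hlim]. }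
  replace p2 with (p1 * p1 - 2 * e 2%nat) by (unfold p1, p2; ring).
  apply is_lim_seq_ext with (2 := H); intros N; rewrite psum_2; ring.
Qed.

Lemma psum_3_lim : is_lim_seq (fun N => psum (L N) 3) p3.
Proof.
  assert (H : is_lim_seq (fun N => esym (L N) 1 * (esym (L N) 1 * esym (L N) 1)
                - 3 * (esym (L N) 1 * esym (L N) 2) + 3 * esym (L N) 3)
                (p1 * (p1 * p1) - 3 * (p1 * e 2%nat) + 3 * e 3%nat)).
  { apply is_lim_seq_plus'; [apply is_lim_seq_minus'|].
    - apply is_lim_seq_mult'; [|apply is_lim_seq_mult']; apply Hlim.
    - apply is_lim_seq_mult'; [apply is_lim_seq_const|].
      apply is_lim_seq_mult'; apply Hlim.
    - apply is_lim_seq_mult'; [apply is_lim_seq_const|apply Hlim]. }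
  replace p3 with (p1 * (p1 * p1) - 3 * (p1 * e 2%nat) + 3 * e 3%nat)
    by (unfold p1, p3; ring).
  apply is_lim_seq_ext with (2 := H); intros N; rewrite psum_3; ring.
Qed.

Lemma esym_alt_le N k x : Rabs (alt (esym (L N)) k * x ^ k) <= e k * Rabs x ^ k.
Proof.
  unfold alt; rewrite !Rabs_mult, pow_1_abs, Rmult_1_l, RPow_abs.
  apply Rmult_le_compat_r; [apply Rabs_pos|].
  rewrite Rabs_pos_eq; [apply Hle|apply esym_ge0, HL].
Qed.

Lemma esym_alt_lim k x :
  is_lim_seq (fun N => alt (esym (L N)) k * x ^ k) (alt e k * x ^ k).
Proof.
  apply is_lim_seq_mult'; [|apply is_lim_seq_const].
  apply is_lim_seq_mult'; [apply is_lim_seq_const|apply Hlim].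
Qed.

Lemma rprod_lim x : is_lim_seq (fun N => rprod (L N) x) (psi x).
Proof.
  assert (H := tannery _ _ _ (ex_series_entire e He Hratio (Rabs x))
                 (fun N k => esym_alt_le N k x) (fun k => esym_alt_lim k x)).
  apply is_lim_seq_ext with (2 := H); intros N.
  apply is_series_unique, rprod_series.
Qed.

(** A Hurwitz argument: [psi] has a positive minimum on [0, x], and a root 1/t <= x of an
    approximant would put [psi] there within the uniform distance on [0, x], which tends to 0. *)
Lemma eventually_roots_large x : 0 < x -> (forall y, 0 <= y <= x -> 0 < psi y) ->
  eventually (fun N => forall t, In t (L N) -> t * x < 1).
Proof.
  intros Hx Hpsi.
  destruct (continuity_ab_min psi 0 x) as (m & Hmin & Hm); [lra| |].
  { intros y _; apply PSeries_alt_continuity; assumption. }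
  assert (Hd := tannery_abs _ _ _ (ex_series_entire e He Hratio (Rabs x))
                 (fun N k => esym_alt_le N k x) (fun k => esym_alt_lim k x)).
  assert (Hex := tannery_ex_diff _ _ _ (ex_series_entire e He Hratio (Rabs x))
                 (fun N k => esym_alt_le N k x) (fun k => esym_alt_lim k x)).
  destruct (eventually_lt _ _ (psi m) Hd (Hpsi m Hm)) as [N0 HN0].
  exists N0; intros N HN t Ht; specialize (HN0 N HN).
  apply Rnot_le_lt; intros Htx.
  assert (Ht0 := HL N t Ht).
  assert (Hy : 0 <= / t <= x).
  { split; [left; now apply Rinv_0_lt_compat|].
    apply (Rmult_le_reg_l t); [exact Ht0|]; rewrite Rinv_r by lra; exact Htx. }
  set (y := / t) in *.
  assert (H0 : rprod (L N) y = 0) by (apply rprod_root; [exact Ht|lra]).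
  assert (E : rprod (L N) y - psi y
              = Series (fun k => alt (esym (L N)) k * y ^ k - alt e k * y ^ k)).
  { rewrite Series_minus.
    - rewrite (is_series_unique _ _ (rprod_series (L N) y)); reflexivity.
    - eexists; apply rprod_series.
    - apply ex_pseries_R, CV_radius_inside.
      rewrite CV_radius_alt by assumption; exact I. }
  assert (Hterm : forall k, Rabs (alt (esym (L N)) k * y ^ k - alt e k * y ^ k)
            <= Rabs (alt (esym (L N)) k * x ^ k - alt e k * x ^ k)).
  { intros k; rewrite <- !Rmult_minus_distr_r, !Rabs_mult.
    apply Rmult_le_compat_l; [apply Rabs_pos|].
    rewrite !Rabs_pos_eq by (apply pow_le; lra).
    apply pow_incr; lra. }
  assert (HS : Rabs (rprod (L N) y - psi y)
     <= Series (fun k => Rabs (alt (esym (L N)) k * x ^ k - alt e k * x ^ k))).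
  { rewrite E; eapply Rle_trans; [apply Series_Rabs|apply Series_le].
    - apply ex_series_Rle with (2 := Hex N).
      intros k; rewrite Rabs_Rabsolu; apply Hterm.
    - intros k; split; [apply Rabs_pos|apply Hterm].
    - apply Hex. }
  assert (Hpy := Hmin y Hy).
  assert (Hpm := Hpsi m Hm).
  rewrite H0, Rminus_0_l, Rabs_Ropp, Rabs_pos_eq in HS; [|assert (H := Hpsi y Hy); lra].
  lra.
Qed.

Section PositiveBelow.

Variable x : R.
Hypothesis Hx : 0 < x.
Hypothesis Hpsi : forall y, 0 <= y < x -> 0 < psi y.

Lemma eventually_roots_below y : 0 < y < x ->
  eventually (fun N => forall t, In t (L N) -> 0 < t /\ t * y < 1).
Proof.
  intros Hy; destruct (eventually_roots_large y) as [N0 H].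
  - lra.
  - intros z Hz; apply Hpsi; lra.
  - exists N0; intros N HN t Ht; split; [now apply (HL N)|now apply (H N)].
Qed.

(** Passage to y = x by continuity: [psi] may vanish at x itself, so the roots of the approximants
    are controlled only beyond each y < x. *)
Lemma le_of_below (a b : R) : (forall y, 0 < y < x -> y * a <= b) -> x * a <= b.
Proof.
  intros H; apply Rnot_lt_le; intros Hlt.
  destruct (Rle_or_lt a 0) as [Ha|Ha].
  - specialize (H (x / 2) ltac:(lra)).
    assert (Hxa : x * a <= 0) by nra.
    nra.
  - assert (Hb : b / a < x).
    { apply (Rmult_lt_reg_r a); [exact Ha|]; unfold Rdiv.
      rewrite Rmult_assoc, Rinv_l, Rmult_1_r by lra; exact Hlt. }
    set (y := Rmax (x / 2) ((b / a + x) / 2)).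
    assert (Hy1 := Rmax_l (x / 2) ((b / a + x) / 2)).
    assert (Hy2 := Rmax_r (x / 2) ((b / a + x) / 2)).
    assert (Hy3 : y < x) by (apply Rmax_lub_lt; lra).
    fold y in Hy1, Hy2.
    specialize (H y ltac:(lra)).
    assert (Hya : b / a < y) by lra.
    apply (Rmult_lt_compat_r a) in Hya; [|exact Ha].
    unfold Rdiv in Hya; rewrite Rmult_assoc, Rinv_l, Rmult_1_r in Hya by lra; lra.
Qed.

Lemma p2_le : x * p2 <= p1.
Proof.
  apply le_of_below; intros y Hy.
  assert (H : 0 <= p1 - y * p2); [|lra].
  apply (is_lim_seq_ge_eventually (fun N => psum (L N) 1 - y * psum (L N) 2)).
  - apply is_lim_seq_minus'; [apply psum_1_lim|].
    apply is_lim_seq_mult'; [apply is_lim_seq_const|apply psum_2_lim].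
  - destruct (eventually_roots_below y Hy) as [N0 H]; exists N0; intros N HN.
    assert (y * psum (L N) 2 <= psum (L N) 1); [|lra].
    apply psum_S_le; intros t Ht; specialize (H N HN t Ht); lra.
Qed.

Lemma p3_le : x * p3 <= p2.
Proof.
  apply le_of_below; intros y Hy.
  assert (H : 0 <= p2 - y * p3); [|lra].
  apply (is_lim_seq_ge_eventually (fun N => psum (L N) 2 - y * psum (L N) 3)).
  - apply is_lim_seq_minus'; [apply psum_2_lim|].
    apply is_lim_seq_mult'; [apply is_lim_seq_const|apply psum_3_lim].
  - destruct (eventually_roots_below y Hy) as [N0 H]; exists N0; intros N HN.
    assert (y * psum (L N) 3 <= psum (L N) 2); [|lra].
    apply psum_S_le; intros t Ht; specialize (H N HN t Ht); lra.
Qed.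

(** Limit of [psum_gap] with T = p1, which bounds every t uniformly in N because t <= [esym (L N) 1]
    <= [e 1]. *)
Lemma gap_le : p2 - x * p3 <= p1 * (p1 - x * p2).
Proof.
  assert (H : x * (p1 * p2 - p3) <= p1 * p1 - p2); [|lra].
  apply le_of_below; intros y Hy.
  assert (H : 0 <= p1 * (p1 - y * p2) - (p2 - y * p3)); [|lra].
  apply (is_lim_seq_ge_eventually (fun N => p1 * (psum (L N) 1 - y * psum (L N) 2)
           - (psum (L N) 2 - y * psum (L N) 3))).
  - apply is_lim_seq_minus'.
    + apply is_lim_seq_mult'; [apply is_lim_seq_const|].
      apply is_lim_seq_minus'; [apply psum_1_lim|].
      apply is_lim_seq_mult'; [apply is_lim_seq_const|apply psum_2_lim].
    + apply is_lim_seq_minus'; [apply psum_2_lim|].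
      apply is_lim_seq_mult'; [apply is_lim_seq_const|apply psum_3_lim].
  - destruct (eventually_roots_below y Hy) as [N0 H]; exists N0; intros N HN.
    assert (psum (L N) 2 - y * psum (L N) 3
            <= p1 * (psum (L N) 1 - y * psum (L N) 2)); [|lra].
    apply psum_gap; intros t Ht; specialize (H N HN t Ht).
    repeat split; try lra.
    apply Rle_trans with (psum (L N) 1).
    + rewrite <- (pow_1 t); apply psum_in; [apply HL|exact Ht].
    + rewrite psum_1; apply Hle.
Qed.

(** With g = 1/y for y < x, since the reciprocal roots are eventually below each such 1/y. *)
Lemma newton_defect_limit_bounds y n : 0 < y < x ->
  0 <= newton_defect e p1 p2 (/ y) n <= (/ y * p2 - p3) * e n.
Proof.
  intros Hy.
  assert (HD : is_lim_seq (fun N => newton_defect (esym (L N)) (psum (L N) 1)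
                                      (psum (L N) 2) (/ y) n)
                          (newton_defect e p1 p2 (/ y) n)).
  { unfold newton_defect.
    assert (Hm : forall u l k, is_lim_seq u (Finite l) ->
                 is_lim_seq (fun N => u N * esym (L N) k) (l * e k))
      by (intros; apply is_lim_seq_mult'; [assumption|apply Hlim]).
    apply is_lim_seq_plus'; [apply is_lim_seq_minus'; [apply is_lim_seq_minus'|]|
      apply is_lim_seq_mult'; [apply is_lim_seq_const|apply is_lim_seq_minus']];
      apply Hm; first [apply psum_1_lim|apply psum_2_lim|apply is_lim_seq_const]. }
  assert (HB : is_lim_seq (fun N => (/ y * psum (L N) 2 - psum (L N) 3) * esym (L N) n)
                 ((/ y * p2 - p3) * e n)).
  { apply is_lim_seq_mult'; [|apply Hlim].
    apply is_lim_seq_minus'; [|apply psum_3_lim].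
    apply is_lim_seq_mult'; [apply is_lim_seq_const|apply psum_2_lim]. }
  assert (Hev : eventually (fun N =>
     0 <= newton_defect (esym (L N)) (psum (L N) 1) (psum (L N) 2) (/ y) n
       <= (/ y * psum (L N) 2 - psum (L N) 3) * esym (L N) n)).
  { destruct (eventually_roots_below y Hy) as [N0 H]; exists N0; intros N HN.
    apply newton_defect_bounds; intros t Ht; specialize (H N HN t Ht).
    split; [lra|].
    apply (Rmult_le_reg_r y); [lra|]; rewrite Rinv_l by lra; lra. }
  split.
  - apply (is_lim_seq_ge_eventually _ _ _ HD).
    destruct Hev as [N0 H]; exists N0; intros N HN; now apply H.
  - assert (H : 0 <= (/ y * p2 - p3) * e n - newton_defect e p1 p2 (/ y) n); [|lra].
    apply (is_lim_seq_ge_eventually _ _ _ (is_lim_seq_minus' _ _ _ _ HB HD)).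
    destruct Hev as [N0 H]; exists N0; intros N HN; specialize (H N HN); lra.
Qed.

(* If equality held, the Newton defect would vanish identically and the
   coefficients [e n] would decay only geometrically. *)
Lemma p3_lt : x * p3 < p2.
Proof.
  destruct p3_le as [H|H]; [exact H|exfalso].
  apply (newton_defect_nonzero e He Hratio p1 p2 (/ x)).
  { now apply Rinv_0_lt_compat. }
  intros n; unfold newton_defect.
  set (a := p1 * e (n + 2)%nat - INR (n + 3) * e (n + 3)%nat - p2 * e (n + 1)%nat).
  set (b := p1 * e (n + 1)%nat - INR (n + 2) * e (n + 2)%nat).
  (* Multiplied by y, the bounds are affine in y and extend to y = x, where x p3 = p2 makes the
     upper one 0. *)
  assert (Hab : forall y, 0 < y < x -> 0 <= y * a + b <= (p2 - y * p3) * e n).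
  { intros y Hy; assert (B := newton_defect_limit_bounds y n Hy).
    unfold newton_defect in B; fold a b in B.
    replace (y * a + b) with (y * (a + / y * b)) by (field; lra).
    replace ((p2 - y * p3) * e n) with (y * ((/ y * p2 - p3) * e n)) by (field; lra).
    split; [apply Rmult_le_pos; lra|apply Rmult_le_compat_l; lra]. }
  assert (H1 : x * - a <= b) by (apply le_of_below; intros y Hy; specialize (Hab y Hy); lra).
  assert (H2 : x * (a + p3 * e n) <= p2 * e n - b)
    by (apply le_of_below; intros y Hy; specialize (Hab y Hy); lra).
  rewrite <- H in H2.
  replace b with (- (x * a)) by lra; field; lra.
Qed.

(** Equality would make the right side of [gap_le] vanish, so p2 <= x p3 against [p3_lt]. *)
Lemma p2_lt : x * p2 < p1.
Proof.
  destruct p2_le as [H|H]; [exact H|exfalso].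
  assert (H1 := gap_le); assert (H2 := p3_lt).
  rewrite H in H1; rewrite Rminus_diag, Rmult_0_r in H1; lra.
Qed.

End PositiveBelow.

Lemma p3_ge0 : 0 <= p3.
Proof.
  apply (is_lim_seq_ge_eventually _ _ _ psum_3_lim).
  exists 0%nat; intros N _; apply psum_ge0, HL.
Qed.

(** If [psi] stayed positive, the strict bounds would hold for every x > 0, and x = p1/p2
    contradicts [p2_lt]. *)
Lemma psi_nonpos : exists x, 0 <= x /\ psi x <= 0.
Proof.
  apply NNPP; intros H.
  assert (Hpsi : forall y, 0 <= y -> 0 < psi y).
  { intros y Hy; apply Rnot_le_lt; intros Hle'; apply H; now exists y. }
  assert (H3 := p3_ge0).
  assert (H2 : 0 < p2).
  { assert (H1 := p3_lt 1 ltac:(lra) (fun y h => Hpsi y (proj1 h))); lra. }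
  assert (H1 : 0 < p1) by apply He.
  assert (Hc := p2_lt (p1 / p2) ltac:(now apply Rdiv_lt_0_compat)
                  (fun y h => Hpsi y (proj1 h))).
  unfold Rdiv in Hc; rewrite Rmult_assoc, Rinv_l in Hc by lra; lra.
Qed.

(** The supremum of the x such that [psi] is positive on [0, x]; continuity rules out either sign
    there. *)
Lemma psi_first_root : exists gam, 0 < gam /\ psi gam = 0 /\
  forall y, 0 <= y < gam -> 0 < psi y.
Proof.
  set (E := fun x => 0 <= x /\ forall y, 0 <= y <= x -> 0 < psi y).
  destruct psi_nonpos as (b & Hb & Hpb).
  assert (HE0 : E 0).
  { split; [lra|]; intros y Hy; replace y with 0 by lra; rewrite psi_0; lra. }
  destruct (completeness E) as (gam & Hub & Hlub).
  { exists b; intros x [Hx0 Hx]; apply Rnot_lt_le; intros Hlt.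
    specialize (Hx b ltac:(lra)); lra. }
  { now exists 0. }
  assert (Hgam0 : 0 <= gam) by now apply Hub.
  assert (Hbelow : forall y, 0 <= y < gam -> 0 < psi y).
  { intros y Hy; apply NNPP; intros Hn.
    assert (gam <= y); [|lra].
    apply Hlub; intros x [Hx0 Hx]; apply Rnot_lt_le; intros Hlt.
    apply Hn, Hx; lra. }
  assert (Hcont : continuity_pt psi gam)
    by (apply PSeries_alt_continuity; assumption).
  assert (Hnear : forall eps, 0 < eps -> exists d, 0 < d /\
    forall y, Rabs (y - gam) < d -> Rabs (psi y - psi gam) < eps).
  { intros eps Heps; destruct (Hcont eps Heps) as (d & Hd & H).
    exists d; split; [exact Hd|]; intros y Hy.
    destruct (Req_dec y gam) as [->|Hne].
    - rewrite Rminus_diag, Rabs_R0; exact Heps.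
    - apply H; split; [split; [exact I|congruence]|exact Hy]. }
  assert (Hroot : psi gam = 0).
  { destruct (Rtotal_order (psi gam) 0) as [Hneg|[H|Hp]]; [exfalso|exact H|exfalso].
    - destruct (Hnear (- psi gam)) as (d & Hd & H); [lra|].
      assert (Hg : 0 < gam).
      { destruct Hgam0 as [Hg|Hg]; [exact Hg|].
        rewrite <- Hg, psi_0 in Hneg; lra. }
      set (y := Rmax 0 (gam - d / 2)).
      assert (Hy1 := Rmax_l 0 (gam - d / 2)); assert (Hy2 := Rmax_r 0 (gam - d / 2)).
      fold y in Hy1, Hy2.
      assert (Hy3 : y < gam) by (apply Rmax_lub_lt; lra).
      assert (Hyp := Hbelow y ltac:(lra)).
      specialize (H y ltac:(apply Rabs_def1; lra)); apply Rabs_def2 in H; lra.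
    - destruct (Hnear (psi gam)) as (d & Hd & H); [lra|].
      assert (Hin : E (gam + d / 2)).
      { split; [lra|]; intros y Hy.
        destruct (Rlt_or_le y gam) as [Hlt|Hge]; [apply Hbelow; lra|].
        specialize (H y ltac:(apply Rabs_def1; lra)); apply Rabs_def2 in H; lra. }
      specialize (Hub _ Hin); lra. }
  exists gam; split; [|now split].
  destruct Hgam0 as [Hg|Hg]; [exact Hg|].
  rewrite <- Hg, psi_0 in Hroot; lra.
Qed.

(** If gam^3 p3 < 1, then eventually every t gam is at most 1 - d for a fixed d > 0, and
    [rprod_ge_exp] keeps the products at gam above a positive constant, so [psi gam] would be
    positive. *)
Lemma p3_lower gam : 0 < gam -> psi gam = 0 -> 1 <= gam ^ 3 * p3.
Proof.
  intros Hg Hroot; apply Rnot_lt_le; intros Hlt.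
  assert (H3 := p3_ge0).
  assert (Hg3 : 0 < gam ^ 3) by now apply pow_lt.
  set (th := (1 + gam ^ 3 * p3) / 2).
  set (d := (1 - th) / 3).
  assert (Hth : 0 < th < 1) by (assert (0 <= gam ^ 3 * p3) by (apply Rmult_le_pos; lra); unfold th; lra).
  assert (Hd : 0 < d) by (unfold d; lra).
  assert (Hlim3 : is_lim_seq (fun N => gam ^ 3 * psum (L N) 3) (gam ^ 3 * p3))
    by (apply is_lim_seq_mult'; [apply is_lim_seq_const|apply psum_3_lim]).
  destruct (eventually_lt _ _ th Hlim3) as [N0 HN0]; [unfold th; lra|].
  assert (Hpos : exp (- (gam * p1 / d)) <= psi gam).
  { apply (is_lim_seq_ge_eventually _ _ _ (rprod_lim gam)).
    exists N0; intros N HN; specialize (HN0 N HN).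
    apply Rle_trans with (exp (- (gam * psum (L N) 1 / d))).
    - assert (Hexp : forall a b, a <= b -> exp a <= exp b).
      { intros a b [Hab| ->]; [left; now apply exp_increasing|apply Rle_refl]. }
      apply Hexp.
      apply Ropp_le_contravar, Rmult_le_compat_r; [left; now apply Rinv_0_lt_compat|].
      apply Rmult_le_compat_l; [lra|]; rewrite psum_1; apply Hle.
    - apply rprod_ge_exp; [lra|exact Hd|].
      intros t Ht; assert (Ht0 := HL N t Ht); split; [exact Ht0|].
      assert (Ht3 := psum_in (L N) 3 t (HL N) Ht).
      set (u := t * gam).
      assert (Hu : 0 < u) by (apply Rmult_lt_0_compat; lra).
      assert (Hu3 : u ^ 3 < th).
      { unfold u; rewrite Rpow_mult_distr.
        apply Rle_lt_trans with (2 := HN0); rewrite Rmult_comm.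
        apply Rmult_le_compat_l; lra. }
      assert (Hu1 : u < 1).
      { apply Rnot_le_lt; intros Hge; assert (1 <= u ^ 3) by (apply pow_R1_Rle; exact Hge).
        lra. }
      (* This product is u^3 - 3 u + 2, so u <= 1 - (1 - u^3)/3; hence the choice d = (1 - th)/3. *)
      assert (0 <= (1 - u) * (1 - u) * (2 + u))
        by (apply Rmult_le_pos; [apply Rmult_le_pos|]; lra).
      change (u <= 1 - d); unfold d; lra. }
  assert (He' := exp_pos (- (gam * p1 / d))); lra.
Qed.

(** Only the cubic lower bound comes from the root; the others descend from it by the chain 1 <=
    gam^3 p3 < gam^2 p2 < gam p1. *)
Theorem euler_rayleigh : exists gam,
  0 < gam /\ psi gam = 0 /\ (forall y, 0 <= y < gam -> 0 < psi y) /\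
  1 < gam * p1 /\ gam * p2 < p1 /\ 1 < gam ^ 2 * p2 /\ gam * p3 < p2 /\ 0 < p3.
Proof.
  destruct psi_first_root as (gam & Hg & Hroot & Hbelow).
  assert (H1 := p2_lt gam Hg Hbelow); assert (H2 := p3_lt gam Hg Hbelow).
  assert (H3 := p3_lower gam Hg Hroot).
  assert (H4 : 1 < gam ^ 2 * p2).
  { apply Rle_lt_trans with (1 := H3).
    replace (gam ^ 3 * p3) with (gam ^ 2 * (gam * p3)) by ring.
    apply Rmult_lt_compat_l; [now apply pow_lt|exact H2]. }
  assert (Hg3 : 0 < gam ^ 3) by now apply pow_lt.
  exists gam; repeat split; try assumption.
  - apply Rlt_trans with (1 := H4).
    replace (gam ^ 2 * p2) with (gam * (gam * p2)) by ring.
    now apply Rmult_lt_compat_l.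
  - apply (Rmult_lt_reg_l (gam ^ 3)); [exact Hg3|lra].
Qed.

End RealRootedLimit.

(** * Approximation of the Hahn-Exton series *)

(** For Q = q^N this is (-Q)^k (q^(-N);q)_k; for Q = 0 it is q^(k(k-1)/2). *)
Fixpoint wprod (q Q : R) (k : nat) : R :=
  match k with
  | O => 1
  | S m => wprod q Q m * (q ^ m - Q)
  end.

(* For [Q = q^N] these are, up to the sign [(-1)^k], the coefficients of the N-th
   Wall polynomial in the rescaled variable [q^N x]; for [Q = 0] those of the
   Hahn-Exton series. *)
Definition wcoef (q c Q : R) (k : nat) : R :=
  q ^ k * wprod q Q k / (qpoch q q k * qpoch c q k).

Lemma wall_rescaled q c n k : 0 < q ->
  wall q c n k * (q ^ n) ^ k = (-1) ^ k * wcoef q c (q ^ n) k.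
Proof.
  intros Hq; unfold wall, wcoef.
  assert (E : qpoch (/ q ^ n) q k * (q ^ n) ^ k = (-1) ^ k * wprod q (q ^ n) k).
  { assert (HQ : q ^ n <> 0) by (apply pow_nonzero; lra).
    induction k as [|k IH]; [simpl; ring|].
    simpl qpoch; simpl wprod.
    replace (qpoch (/ q ^ n) q k * (1 - / q ^ n * q ^ k) * (q ^ n) ^ S k)
      with (qpoch (/ q ^ n) q k * (q ^ n) ^ k * (q ^ n - q ^ k))
      by (simpl; field; exact HQ).
    rewrite IH; simpl; ring. }
  transitivity (q ^ k * (qpoch (/ q ^ n) q k * (q ^ n) ^ k) * / (qpoch q q k * qpoch c q k)).
  { unfold Rdiv; ring. }
  rewrite E; unfold Rdiv; ring.
Qed.

Lemma is_lim_seq_INR_pow q : 0 < q < 1 -> is_lim_seq (fun k => INR (S k) * q ^ k) 0.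
Proof.
  intros Hq; apply ex_series_lim_0.
  assert (HI : forall k, 0 < INR (S k)) by (intros; apply lt_0_INR; lia).
  assert (Hp : forall k, 0 < q ^ k) by (intros; apply pow_lt; lra).
  apply ex_series_Rabs, ex_series_DAlembert with q; [lra| |].
  - intros k; apply Rgt_not_eq, Rmult_lt_0_compat; [apply HI|apply Hp].
  - assert (H : is_lim_seq (fun k => q + q * / INR (S k)) (q + q * 0)).
    { apply is_lim_seq_plus'; [apply is_lim_seq_const|].
      apply is_lim_seq_mult'; [apply is_lim_seq_const|].
      apply (is_lim_seq_inv _ p_infty); [|easy].
      apply (is_lim_seq_incr_1 INR), is_lim_seq_INR. }
    rewrite Rmult_0_r, Rplus_0_r in H.
    apply is_lim_seq_ext with (2 := H); intros k.
    assert (H1 := HI k); assert (H2 := HI (S k)); assert (H3 := Hp k).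
    rewrite Rabs_pos_eq.
    + rewrite (S_INR (S k)); simpl (q ^ S k); field; lra.
    + left; apply Rdiv_lt_0_compat; apply Rmult_lt_0_compat; try lra; apply Hp.
Qed.

Section WallLimit.

Variables q c : R.
Hypothesis Hq : 0 < q < 1.
Hypothesis Hc : 0 < c < 1.

Lemma qpoch2_pos k : 0 < qpoch q q k * qpoch c q k.
Proof. apply Rmult_lt_0_compat; now apply qpoch_pos. Qed.

Lemma wprod_vanish n k : (n < k)%nat -> wprod q (q ^ n) k = 0.
Proof. induction 1 as [|k Hk IH]; simpl; [|rewrite IH]; ring. Qed.

(** For k <= n each factor satisfies 0 <= q^m - q^n <= q^m; for k > n the factor with m = n is 0.
    This is the majorant uniform in n for all limits of approximants. *)
Lemma wprod_le n k : wprod q (q ^ n) k <= wprod q 0 k.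
Proof.
  assert (H0 : forall m, 0 < wprod q 0 m).
  { induction m as [|m IH]; simpl; [lra|].
    apply Rmult_lt_0_compat; [exact IH|]; rewrite Rminus_0_r; apply pow_lt; lra. }
  destruct (Nat.le_gt_cases k n) as [Hk|Hk].
  - assert (H : 0 <= wprod q (q ^ n) k <= wprod q 0 k); [|apply H].
    induction k as [|k IH]; simpl; [lra|].
    specialize (IH ltac:(lia)).
    assert (Hqn : 0 < q ^ n) by (apply pow_lt; lra).
    assert (Hqk : q ^ n <= q ^ k).
    { replace n with (k + (n - k))%nat by lia; rewrite pow_add.
      assert (0 < q ^ k) by (apply pow_lt; lra).
      assert (Hl := pow_lt_1 q (n - k) Hq); nra. }
    split; [apply Rmult_le_pos|apply Rmult_le_compat]; lra.
  - rewrite wprod_vanish by exact Hk; left; apply H0.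
Qed.

Lemma wcoef_le n k : wcoef q c (q ^ n) k <= wcoef q c 0 k.
Proof.
  unfold wcoef; apply Rmult_le_compat_r.
  - left; apply Rinv_0_lt_compat, qpoch2_pos.
  - apply Rmult_le_compat_l; [apply pow_le; lra|apply wprod_le].
Qed.

Lemma wcoef_lim k : is_lim_seq (fun n => wcoef q c (q ^ n) k) (wcoef q c 0 k).
Proof.
  assert (H : is_lim_seq (fun n => wprod q (q ^ n) k) (wprod q 0 k)).
  { induction k as [|k IH]; simpl; [apply is_lim_seq_const|].
    apply is_lim_seq_mult'; [exact IH|].
    apply is_lim_seq_minus'; [apply is_lim_seq_const|].
    apply is_lim_seq_geom; rewrite Rabs_pos_eq; lra. }
  apply is_lim_seq_mult'; [|apply is_lim_seq_const].
  apply is_lim_seq_mult'; [apply is_lim_seq_const|exact H].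
Qed.

Lemma wcoef_S k :
  wcoef q c 0 (S k) = wcoef q c 0 k * (q * q ^ k / ((1 - q * q ^ k) * (1 - c * q ^ k))).
Proof.
  unfold wcoef; simpl.
  assert (Hk := qpoch2_pos k).
  assert (H1 := qpoch_factor_pos q q k Hq Hq); assert (H2 := qpoch_factor_pos c q k Hq Hc).
  assert (H3 := qpoch_pos q q k Hq Hq); assert (H4 := qpoch_pos c q k Hq Hc).
  field; lra.
Qed.

Lemma wcoef_pos k : 0 < wcoef q c 0 k.
Proof.
  induction k as [|k IH]; [unfold wcoef; simpl; lra|].
  rewrite wcoef_S; apply Rmult_lt_0_compat; [exact IH|].
  assert (0 < q ^ k) by (apply pow_lt; lra).
  apply Rdiv_lt_0_compat; repeat apply Rmult_lt_0_compat; try lra;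
    now apply qpoch_factor_pos.
Qed.

Lemma odd_weight_ratio_lim :
  is_lim_seq (fun k => INR (S k) * (odd_weight (wcoef q c 0) (S k)
                                    / odd_weight (wcoef q c 0) k)) 0.
Proof.
  (* The 3 bounds (2k+3)/(2k+1), and the factors 1 - q^(k+1) and 1 - c q^k are smallest at k = 0. *)
  set (M := 3 / ((1 - q) * (1 - c))).
  apply is_lim_seq_0_abs_le with (fun k => M * (INR (S k) * q ^ k)).
  2: { replace (Finite 0) with (Finite (M * 0)) by (f_equal; ring).
       apply is_lim_seq_mult'; [apply is_lim_seq_const|now apply is_lim_seq_INR_pow]. }
  intros k; unfold odd_weight; rewrite wcoef_S, S_INR.
  assert (Hk := pos_INR k); assert (Hw := wcoef_pos k).
  assert (H1 := qpoch_factor_pos q q k Hq Hq); assert (H2 := qpoch_factor_pos c q k Hq Hc).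
  assert (Hp := pow_lt_1 q k Hq).
  replace ((2 * (INR k + 1) + 1) * (wcoef q c 0 k *
             (q * q ^ k / ((1 - q * q ^ k) * (1 - c * q ^ k))))
           / ((2 * INR k + 1) * wcoef q c 0 k))
    with ((2 * INR k + 3) / (2 * INR k + 1)
          * q * q ^ k * / ((1 - q * q ^ k) * (1 - c * q ^ k)))
    by (field; lra).
  assert (Ha : 0 < (2 * INR k + 3) / (2 * INR k + 1) <= 3).
  { split; [apply Rdiv_lt_0_compat; lra|].
    apply (Rmult_le_reg_r (2 * INR k + 1)); [lra|]; unfold Rdiv.
    rewrite Rmult_assoc, Rinv_l by lra; lra. }
  assert (Hb : 0 < q * q ^ k <= 1) by nra.
  assert (Hinv : 0 < / ((1 - q * q ^ k) * (1 - c * q ^ k)) <= / ((1 - q) * (1 - c))).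
  { split; [apply Rinv_0_lt_compat, Rmult_lt_0_compat; lra|].
    apply Rinv_le_contravar; [apply Rmult_lt_0_compat; lra|].
    apply Rmult_le_compat; try lra; nra. }
  set (A := (2 * INR k + 3) / (2 * INR k + 1)) in *.
  set (C := / ((1 - q * q ^ k) * (1 - c * q ^ k))) in *.
  rewrite Rabs_pos_eq.
  - unfold M, Rdiv.
    replace (3 * / ((1 - q) * (1 - c)) * ((INR k + 1) * q ^ k))
      with ((INR k + 1) * (3 * 1 * q ^ k * / ((1 - q) * (1 - c)))) by ring.
    apply Rmult_le_compat_l; [lra|].
    apply Rmult_le_compat; [apply Rmult_le_pos; [apply Rmult_le_pos|]; lra|lra| |lra].
    apply Rmult_le_compat_r; [lra|].
    apply Rmult_le_compat; lra.
  - apply Rmult_le_pos; [lra|].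
    apply Rmult_le_pos; [apply Rmult_le_pos; [apply Rmult_le_pos|]|]; lra.
Qed.

(** [L N] holds the reciprocal roots of Q_N and [L' N] those of P_N, so the prime sits on P here
    while in [wall_roots_pair] it sits on Q. *)
Lemma real_rooted_approximants : exists L L' : nat -> list R,
  (forall N t, In t (L N) -> 0 < t) /\
  (forall N t, In t (L' N) -> 0 < t) /\
  (forall N t, In t (L' N) -> exists t', In t' (L N) /\ t <= t') /\
  (forall N k, esym (L' N) k = wcoef q c (q ^ N) k) /\
  (forall N k, esym (L N) k = odd_weight (wcoef q c (q ^ N)) k).
Proof.
  assert (H : forall N, exists p : list R * list R,
    (forall t, In t (fst p) -> 0 < t) /\ (forall t, In t (snd p) -> 0 < t) /\
    (forall t, In t (snd p) -> exists t', In t' (fst p) /\ t <= t') /\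
    (forall k, esym (snd p) k = wcoef q c (q ^ N) k) /\
    (forall k, esym (fst p) k = odd_weight (wcoef q c (q ^ N)) k)).
  { intros N; destruct (wall_roots_pair q c Hq Hc N) as (x & x' & Hx & Hw & Ho).
    assert (HQ : 0 < q ^ N) by (apply pow_lt; lra).
    (* A root x of p_N becomes the root x / q^N of p_N(q^N w), with reciprocal q^N / x. *)
    set (sc := map (fun t => t * q ^ N)).
    assert (Hsc : forall y, (forall i, (i < N)%nat -> 0 < y i) ->
              forall t, In t (sc (inv_list y N)) -> 0 < t).
    { intros y Hy t Ht; apply in_map_iff in Ht as (s & <- & Hs).
      apply inv_list_in in Hs as (i & Hi & ->).
      apply Rmult_lt_0_compat; [apply Rinv_0_lt_compat; now apply Hy|exact HQ]. }
    assert (Halt : forall f y, (forall k, f k = alt (esym (inv_list y N)) k) ->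
              forall k, esym (sc (inv_list y N)) k = (-1) ^ k * (f k * (q ^ N) ^ k)).
    { intros f y Hf k; unfold sc; rewrite esym_scale, Hf; unfold alt.
      rewrite <- !Rmult_assoc, pow_m1_sq; ring. }
    exists (sc (inv_list x' N), sc (inv_list x N)); simpl fst; simpl snd.
    repeat split.
    - apply Hsc; intros i Hi; now apply Hx.
    - apply Hsc; intros i Hi; assert (H := Hx i Hi); lra.
    - intros t Ht; apply in_map_iff in Ht as (s & <- & Hs).
      apply inv_list_in in Hs as (i & Hi & ->).
      exists (/ x' i * q ^ N); split.
      + unfold sc; apply (in_map (fun t => t * q ^ N)); now apply in_inv_list.
      + apply Rmult_le_compat_r; [lra|].
        apply Rinv_le_contravar; assert (H := Hx i Hi); lra.
    - intros k; rewrite (Halt _ _ Hw), wall_rescaled by lra.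
      rewrite <- Rmult_assoc, pow_m1_sq; ring.
    - intros k; rewrite (Halt _ _ Ho); unfold odd_weight.
      rewrite Rmult_assoc, wall_rescaled by lra.
      transitivity ((-1) ^ k * (-1) ^ k * ((2 * INR k + 1) * wcoef q c (q ^ N) k)); [ring|].
      rewrite pow_m1_sq; ring. }
  apply functional_choice in H as (p & Hp).
  exists (fun N => fst (p N)), (fun N => snd (p N)).
  repeat split; intros N; apply (Hp N).
Qed.

End WallLimit.

(** * Domination on circles and complex differentiability *)

Lemma im_le_Cmod (z : C) : Rabs (Im z) <= Cmod z.
Proof. apply Rle_trans with (2 := Rmax_Cmod z); apply Rmax_r. Qed.

(** The 2 comes from bounding the real and imaginary parts separately; it only enters the constant
    of a quadratic remainder. *)
Lemma CSeries_Cmod_le (a : nat -> C) (b : nat -> R) :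
  (forall n, Cmod (a n) <= b n) -> ex_series b -> Cmod (CSeries a) <= 2 * Series b.
Proof.
  intros Ha Hb.
  assert (Hpart : forall p : nat -> R, (forall n, Rabs (p n) <= b n) ->
                  Rabs (Series p) <= Series b).
  { intros p Hp; eapply Rle_trans; [apply Series_Rabs|apply Series_le].
    - apply ex_series_Rle with b; [|exact Hb].
      intros k; rewrite Rabs_Rabsolu; apply Hp.
    - intros k; split; [apply Rabs_pos|apply Hp].
    - exact Hb. }
  assert (H1 : Rabs (Re (CSeries a)) <= Series b).
  { apply Hpart; intros n; eapply Rle_trans; [apply re_le_Cmod|apply Ha]. }
  assert (H2 : Rabs (Im (CSeries a)) <= Series b).
  { apply Hpart; intros n; eapply Rle_trans; [apply im_le_Cmod|apply Ha]. }
  rewrite (surjective_pairing (CSeries a)).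
  replace (fst (CSeries a), snd (CSeries a))
    with (Cplus (RtoC (Re (CSeries a))) (Cmult Ci (RtoC (Im (CSeries a))))).
  - eapply Rle_trans; [apply Cmod_triangle|].
    rewrite Cmod_mult, Cmod_Ci, !Cmod_R; lra.
  - unfold Cplus, Cmult, Ci, RtoC, Re, Im; simpl; f_equal; ring.
Qed.

Lemma CSeries_correct (a : nat -> C) (b : nat -> R) :
  (forall n, Cmod (a n) <= b n) -> ex_series b -> is_Cseries a (CSeries a).
Proof.
  intros Ha Hb.
  destruct (@ex_series_le C_AbsRing C_CompleteNormedModule a b) as [l Hl];
    [|exact Hb|].
  - exact Ha.
  - now rewrite (CSeries_unique a l Hl).
Qed.

Lemma Cmod_pterm c z k : Cmod (pterm c z k) = Rabs (c k) * Cmod z ^ k.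
Proof. unfold pterm; now rewrite Cmod_mult, Cmod_R, Cmod_pow. Qed.

Lemma CSeries_pterm_Cmod_lim (c : nat -> nat -> R) (a v : nat -> R) (z : C) :
  (forall N k, Rabs (c N k) <= v k) ->
  (forall k, is_lim_seq (fun N => c N k) (a k)) ->
  ex_series (fun k => v k * Cmod z ^ k) ->
  is_lim_seq (fun N => Cmod (CSeries (pterm (c N) z))) (Cmod (CSeries (pterm a z))).
Proof.
  intros Hc Ha Hv.
  assert (Hb : forall N k, Cmod (pterm (c N) z k) <= v k * Cmod z ^ k).
  { intros N k; rewrite Cmod_pterm; apply Rmult_le_compat_r; [|apply Hc].
    apply pow_le, Cmod_ge_0. }
  assert (HRe : is_lim_seq (fun N => Re (CSeries (pterm (c N) z))) (Re (CSeries (pterm a z)))).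
  { apply (tannery (fun N k => Re (pterm (c N) z k)) _ (fun k => v k * Cmod z ^ k)).
    - exact Hv.
    - intros N k; eapply Rle_trans; [apply re_le_Cmod|apply Hb].
    - intros k; unfold pterm, Cmult, RtoC, Re; simpl.
      apply is_lim_seq_minus'; apply is_lim_seq_mult'; (apply Ha || apply is_lim_seq_const). }
  assert (HIm : is_lim_seq (fun N => Im (CSeries (pterm (c N) z))) (Im (CSeries (pterm a z)))).
  { apply (tannery (fun N k => Im (pterm (c N) z k)) _ (fun k => v k * Cmod z ^ k)).
    - exact Hv.
    - intros N k; eapply Rle_trans; [apply im_le_Cmod|apply Hb].
    - intros k; unfold pterm, Cmult, RtoC, Im; simpl.
      apply is_lim_seq_plus'; apply is_lim_seq_mult'; (apply Ha || apply is_lim_seq_const). }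
  unfold Cmod.
  apply (is_lim_seq_continuous sqrt).
  - apply continuity_pt_sqrt.
    apply Rplus_le_le_0_compat; apply pow2_ge_0.
  - assert (Hsq : forall u l, is_lim_seq u (Finite l) -> is_lim_seq (fun n => u n ^ 2) (l ^ 2)).
    { intros u l H; simpl; apply is_lim_seq_mult'; [exact H|].
      apply is_lim_seq_mult'; [exact H|apply is_lim_seq_const]. }
    apply is_lim_seq_plus'; apply Hsq; [exact HRe|exact HIm].
Qed.

Lemma PSeries_odd_weight a x :
  ex_series (fun k => Rabs (odd_weight a k) * Rabs x ^ k) ->
  PSeries (odd_weight a) x = PSeries a x + 2 * PSeries (ntimes a) x.
Proof.
  intros H.
  assert (Hex : forall b, (forall k, Rabs (b k) <= Rabs (odd_weight a k)) ->
                ex_series (fun k => b k * x ^ k)).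
  { intros b Hb; apply ex_series_Rle with (2 := H).
    intros k; rewrite Rabs_mult, RPow_abs.
    apply Rmult_le_compat_r; [apply Rabs_pos|apply Hb]. }
  assert (Ho : forall k, Rabs (odd_weight a k) = (2 * INR k + 1) * Rabs (a k)).
  { intros k; unfold odd_weight; rewrite Rabs_mult, Rabs_pos_eq; [reflexivity|].
    assert (Hk := pos_INR k); lra. }
  unfold PSeries; rewrite <- Series_scal_l, <- Series_plus.
  - apply Series_ext; intros k; unfold odd_weight, ntimes; ring.
  - apply Hex; intros k; rewrite Ho.
    assert (H1 := pos_INR k); assert (H2 := Rabs_pos (a k)); nra.
  - apply (ex_series_scal 2 (fun k => ntimes a k * x ^ k)), Hex; intros k.
    rewrite Ho; unfold ntimes; rewrite Rabs_mult, (Rabs_pos_eq (INR k)) by apply pos_INR.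
    assert (H1 := pos_INR k); assert (H2 := Rabs_pos (a k)); nra.
Qed.

Lemma odd_weight_alt h k : odd_weight (alt h) k = alt (odd_weight h) k.
Proof. unfold odd_weight, alt; ring. Qed.

Section Starlike.

Variables (L L' : nat -> list R) (h : nat -> R).
Hypothesis HL : forall N t, In t (L N) -> 0 < t.
Hypothesis HL' : forall N t, In t (L' N) -> 0 < t.
Hypothesis HLL : forall N t, In t (L' N) -> exists t', In t' (L N) /\ t <= t'.
Hypothesis HE : forall N k, esym (L N) k = odd_weight (esym (L' N)) k.
Hypothesis Hle : forall N k, esym (L' N) k <= h k.
Hypothesis Hlim : forall k, is_lim_seq (fun N => esym (L' N) k) (h k).
Hypothesis Hh : forall k, 0 < h k.
Hypothesis Hratio :
  is_lim_seq (fun k => INR (S k) * (odd_weight h (S k) / odd_weight h k)) 0.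

Lemma odd_weight_pos k : 0 < odd_weight h k.
Proof.
  unfold odd_weight; apply Rmult_lt_0_compat; [|apply Hh].
  assert (H := pos_INR k); lra.
Qed.

(** The common majorant: [odd_weight h] dominates the coefficients of P_N, of w P_N' and of Q_N
    alike. *)
Lemma ex_series_odd_weight x : ex_series (fun k => odd_weight h k * x ^ k).
Proof. apply ex_series_entire; [apply odd_weight_pos|exact Hratio]. Qed.

Lemma odd_weight_alt_abs k : Rabs (odd_weight (alt h) k) = odd_weight h k.
Proof.
  rewrite odd_weight_alt; unfold alt; rewrite Rabs_mult, pow_1_abs, Rmult_1_l.
  apply Rabs_pos_eq; left; apply odd_weight_pos.
Qed.

Lemma odd_weight_esym_le N k : esym (L N) k <= odd_weight h k.
Proof.
  rewrite HE; unfold odd_weight; apply Rmult_le_compat_l; [|apply Hle].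
  assert (H := pos_INR k); lra.
Qed.

Lemma odd_weight_esym_lim k : is_lim_seq (fun N => esym (L N) k) (odd_weight h k).
Proof.
  apply is_lim_seq_ext with (fun N => (2 * INR k + 1) * esym (L' N) k).
  { intros N; rewrite HE; reflexivity. }
  apply is_lim_seq_mult'; [apply is_lim_seq_const|apply Hlim].
Qed.

Lemma alt_esym_abs_le N k : Rabs (alt (esym (L' N)) k) <= odd_weight h k.
Proof.
  unfold alt; rewrite Rabs_mult, pow_1_abs, Rmult_1_l, Rabs_pos_eq
    by apply esym_ge0, HL'.
  eapply Rle_trans; [apply Hle|]; unfold odd_weight.
  assert (H := pos_INR k); assert (H' := Hh k); nra.
Qed.

Lemma ntimes_esym_abs_le N k : Rabs (ntimes (alt (esym (L' N))) k) <= odd_weight h k.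
Proof.
  assert (Hk := pos_INR k).
  unfold ntimes, alt; rewrite !Rabs_mult, pow_1_abs, Rmult_1_l, (Rabs_pos_eq (INR k)) by exact Hk.
  rewrite Rabs_pos_eq by apply esym_ge0, HL'.
  unfold odd_weight; apply Rmult_le_compat; [exact Hk|apply esym_ge0, HL'|lra|apply Hle].
Qed.

Lemma alt_esym_lim k : is_lim_seq (fun N => alt (esym (L' N)) k) (alt h k).
Proof. apply is_lim_seq_mult'; [apply is_lim_seq_const|apply Hlim]. Qed.

Lemma ntimes_esym_lim k :
  is_lim_seq (fun N => ntimes (alt (esym (L' N))) k) (ntimes (alt h) k).
Proof. apply is_lim_seq_mult'; [apply is_lim_seq_const|apply alt_esym_lim]. Qed.

Lemma PSeries_dominated_lim (cN : nat -> nat -> R) (a : nat -> R) x : 0 <= x ->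
  (forall N k, Rabs (cN N k) <= odd_weight h k) ->
  (forall k, is_lim_seq (fun N => cN N k) (a k)) ->
  is_lim_seq (fun N => PSeries (cN N) x) (PSeries a x).
Proof.
  intros Hx Hb Hl.
  apply (tannery (fun N k => cN N k * x ^ k) _ _ (ex_series_odd_weight x)).
  - intros N k; rewrite Rabs_mult, (Rabs_pos_eq (x ^ k)) by now apply pow_le.
    apply Rmult_le_compat_r; [now apply pow_le|apply Hb].
  - intros k; apply is_lim_seq_mult'; [apply Hl|apply is_lim_seq_const].
Qed.

(** In the limit [ltheta_le] reads T p <= -d P, and strictness is recovered from p + 2 d > 0, the
    value of the weighted series at |w|: 2 T p <= -2 d P < p P. *)
Lemma theta_dominated gam w :
  Cmod w < gam -> (forall y, 0 <= y < gam -> 0 < PSeries (alt (odd_weight h)) y) ->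
  2 * Cmod (CSeries (pterm (ntimes (alt h)) w)) < Cmod (CSeries (pterm (alt h) w)).
Proof.
  intros Hw Hpsi.
  assert (Hw0 := Cmod_ge_0 w).
  set (P := Cmod (CSeries (pterm (alt h) w))).
  set (T := Cmod (CSeries (pterm (ntimes (alt h)) w))).
  set (p := PSeries (alt h) (Cmod w)).
  set (d := PSeries (ntimes (alt h)) (Cmod w)).
  assert (HP : is_lim_seq (fun N => Cmod (lprod (L' N) w)) P).
  { apply is_lim_seq_ext with (fun N => Cmod (CSeries (pterm (alt (esym (L' N))) w))).
    { intros N; now rewrite (CSeries_unique _ _ (lprod_series (L' N) w)). }
    apply CSeries_pterm_Cmod_lim with (odd_weight h).
    - apply alt_esym_abs_le.
    - apply alt_esym_lim.
    - apply ex_series_odd_weight. }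
  assert (HT : is_lim_seq (fun N => Cmod (ltheta (L' N) w)) T).
  { apply is_lim_seq_ext with (fun N => Cmod (CSeries (pterm (ntimes (alt (esym (L' N)))) w))).
    { intros N; now rewrite (CSeries_unique _ _ (ltheta_series (L' N) w)). }
    apply CSeries_pterm_Cmod_lim with (odd_weight h).
    - apply ntimes_esym_abs_le.
    - apply ntimes_esym_lim.
    - apply ex_series_odd_weight. }
  assert (Hp : is_lim_seq (fun N => rprod (L' N) (Cmod w)) p).
  { apply is_lim_seq_ext with (fun N => PSeries (alt (esym (L' N))) (Cmod w)).
    { intros N; apply is_series_unique, rprod_series. }
    apply PSeries_dominated_lim; [exact Hw0|apply alt_esym_abs_le|apply alt_esym_lim]. }
  assert (Hd : is_lim_seq (fun N => rtheta (L' N) (Cmod w)) d).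
  { apply is_lim_seq_ext with (fun N => PSeries (ntimes (alt (esym (L' N)))) (Cmod w)).
    { intros N; apply is_series_unique, rtheta_series. }
    apply PSeries_dominated_lim; [exact Hw0|apply ntimes_esym_abs_le|apply ntimes_esym_lim]. }
  assert (Hev : eventually (fun N => forall t, In t (L' N) -> 0 < t /\ t * Cmod w <= 1)).
  (* A point strictly between |w| and gam, since positivity is required on a closed interval. *)
  { set (y := (Cmod w + gam) / 2).
    destruct (eventually_roots_large L (odd_weight h) HL odd_weight_pos
                odd_weight_esym_le odd_weight_esym_lim Hratio y) as [N0 HN0].
    - unfold y; lra.
    - intros z Hz; apply Hpsi; unfold y in Hz; lra.
    - exists N0; intros N HN t Ht; split; [now apply (HL' N)|].
      destruct (HLL N t Ht) as (t' & Ht' & Htt').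
      assert (H := HN0 N HN t' Ht'); assert (H0 := HL N t' Ht').
      apply Rle_trans with (t' * y); [|lra].
      apply Rmult_le_compat; [left; now apply (HL' N)|exact Hw0|exact Htt'|unfold y; lra]. }
  assert (HpP : 0 <= P - p).
  { apply (is_lim_seq_ge_eventually _ _ _ (is_lim_seq_minus' _ _ _ _ HP Hp)).
    destruct Hev as [N0 H]; exists N0; intros N HN.
    assert (H1 := lprod_ge (L' N) w (H N HN)); lra. }
  assert (Hd0 : 0 <= 0 - d).
  { apply (is_lim_seq_ge_eventually _ _ _
             (is_lim_seq_minus' _ _ _ _ (is_lim_seq_const 0) Hd)).
    destruct Hev as [N0 H]; exists N0; intros N HN.
    assert (H1 := rtheta_le0 (L' N) (Cmod w) Hw0 (H N HN)); lra. }
  assert (Hmain : 0 <= (0 - d) * P - T * p).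
  { apply (is_lim_seq_ge_eventually _ _ _
      (is_lim_seq_minus' _ _ _ _
        (is_lim_seq_mult' _ _ _ _ (is_lim_seq_minus' _ _ _ _ (is_lim_seq_const 0) Hd) HP)
        (is_lim_seq_mult' _ _ _ _ HT Hp))).
    destruct Hev as [N0 H]; exists N0; intros N HN.
    assert (H1 := ltheta_le (L' N) w (H N HN)); lra. }
  assert (Hpsiw : 0 < p + 2 * d).
  { replace (p + 2 * d) with (PSeries (alt (odd_weight h)) (Cmod w)).
    { apply Hpsi; lra. }
    unfold p, d; rewrite <- PSeries_odd_weight.
    - apply PSeries_ext; intros k; symmetry; apply odd_weight_alt.
    - apply ex_series_ext with (2 := ex_series_odd_weight (Cmod w)); intros k.
      now rewrite odd_weight_alt_abs, (Rabs_pos_eq (Cmod w)). }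
  assert (Hp0 : 0 < p) by lra.
  apply (Rmult_lt_reg_r p); [exact Hp0|].
  apply Rle_lt_trans with (2 * ((0 - d) * P)); [lra|].
  assert (0 < P * (p + 2 * d)) by (apply Rmult_lt_0_compat; lra).
  lra.
Qed.

End Starlike.

(** * Complex derivative of odd power series *)

Lemma Cpow_remainder (z k : C) (r : R) m : 1 <= r -> Cmod z <= r -> Cmod (Cplus z k) <= r ->
  Cmod (Cminus (Cminus (Cpow (Cplus z k) (S m)) (Cpow z (S m)))
               (Cmult k (Cmult (RtoC (INR (S m))) (Cpow z m))))
  <= INR (S m) ^ 2 * r ^ m * Cmod k ^ 2.
Proof.
  intros Hr Hz Hzk; assert (Hk := Cmod_ge_0 k).
  induction m as [|m IH].
  - simpl INR; rewrite !Cpow_1_r; simpl Cpow.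
    replace (Cminus (Cminus (Cplus z k) z) (Cmult k (Cmult (RtoC 1) (RtoC 1))))
      with (RtoC 0) by ring.
    rewrite Cmod_0; assert (0 <= Cmod k ^ 2) by apply pow2_ge_0; simpl (r ^ 0); lra.
  - set (E := Cminus (Cminus (Cpow (Cplus z k) (S m)) (Cpow z (S m)))
               (Cmult k (Cmult (RtoC (INR (S m))) (Cpow z m)))) in *.
    replace (Cminus (Cminus (Cpow (Cplus z k) (S (S m))) (Cpow z (S (S m))))
               (Cmult k (Cmult (RtoC (INR (S (S m)))) (Cpow z (S m)))))
      with (Cplus (Cmult (Cplus z k) E)
                  (Cmult (Cmult k k) (Cmult (RtoC (INR (S m))) (Cpow z m)))).
    2: { unfold E; rewrite (S_INR (S m)), RtoC_plus, !Cpow_S; ring. }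
    eapply Rle_trans; [apply Cmod_triangle|].
    rewrite !Cmod_mult, Cmod_R, Cmod_pow, (Rabs_pos_eq (INR (S m))) by apply pos_INR.
    assert (HI : 1 <= INR (S m)) by (rewrite S_INR; assert (H := pos_INR m); lra).
    assert (Hrm : 0 < r ^ m) by (apply pow_lt; lra).
    assert (H1 : Cmod (Cplus z k) * Cmod E <= r * (INR (S m) ^ 2 * r ^ m * Cmod k ^ 2)).
    { apply Rmult_le_compat; [apply Cmod_ge_0|apply Cmod_ge_0|exact Hzk|exact IH]. }
    assert (H2 : Cmod k * Cmod k * (INR (S m) * Cmod z ^ m)
                 <= Cmod k * Cmod k * (INR (S m) * (r * r ^ m))).
    { apply Rmult_le_compat_l; [now apply Rmult_le_pos|].
      apply Rmult_le_compat_l; [lra|].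
      apply Rle_trans with (r ^ m); [apply pow_incr; split; [apply Cmod_ge_0|exact Hz]|].
      nra. }
    rewrite (S_INR (S m)).
    assert (H3 : 0 <= Cmod k * Cmod k * (r * r ^ m) * (INR (S m) + 1)).
    { apply Rmult_le_pos; [|lra]; apply Rmult_le_pos; [now apply Rmult_le_pos|nra]. }
    change (r ^ S m) with (r * r ^ m); lra.
Qed.

Lemma is_derive_C_quadratic (f : C -> C) (z l : C) (M : R) :
  0 <= M ->
  (forall k, Cmod k <= 1 ->
     Cmod (Cminus (Cminus (f (Cplus z k)) (f z)) (Cmult k l)) <= M * Cmod k ^ 2) ->
  is_derive (K := C_AbsRing) (V := C_NormedModule) f z l.
Proof.
  intros HM H; split; [apply is_linear_scal_l|].
  intros x Hx eps.
  assert (Exz : z = x) by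
    exact (is_filter_lim_locally_unique (V := AbsRing_NormedModule C_AbsRing) z x Hx).
  subst x.
  apply (locally_le_locally_norm (V := AbsRing_NormedModule C_AbsRing)).
  (* The 1 keeps the increment in the range of [H]; M + 1 avoids a division by 0 when M = 0. *)
  assert (Hd : 0 < Rmin 1 (eps / (M + 1))).
  { apply Rmin_pos; [lra|]; apply Rdiv_lt_0_compat; [apply eps|lra]. }
  exists (mkposreal _ Hd); intros y Hy.
  change (Cmod (Cminus y z) < Rmin 1 (eps / (M + 1))) in Hy.
  change (Cmod (Cminus (Cminus (f y) (f z)) (Cmult (Cminus y z) l)) <= eps * Cmod (Cminus y z)).
  set (k := Cminus y z) in *.
  replace y with (Cplus z k) by (unfold k; ring).
  assert (H1 := Rmin_l 1 (eps / (M + 1))); assert (H2 := Rmin_r 1 (eps / (M + 1))).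
  eapply Rle_trans; [apply H; lra|].
  assert (Hk := Cmod_ge_0 k).
  assert (He : (M + 1) * Cmod k <= eps).
  { apply (Rmult_le_reg_r (/ (M + 1))); [apply Rinv_0_lt_compat; lra|].
    replace ((M + 1) * Cmod k * / (M + 1)) with (Cmod k) by (field; lra).
    unfold Rdiv in *; lra. }
  simpl; nra.
Qed.

Definition odd_series (a : nat -> R) (z : C) : C :=
  CSeries (fun n => Cmult (RtoC (a n)) (Cpow z (2 * n + 1)%nat)).

(** The Taylor remainder carries (2n+1)^2; one factor belongs to [odd_weight], and the other is
    absorbed into a geometric one. *)
Lemma odd_le_pow3 n : 2 * INR n + 1 <= 3 ^ n.
Proof.
  induction n as [|n IH]; [simpl; lra|].
  rewrite S_INR; simpl; assert (H := pos_INR n); lra.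
Qed.

Section OddSeries.

Variable a : nat -> R.
Hypothesis Ha : forall x, ex_series (fun k => Rabs (odd_weight a k) * x ^ k).

Lemma odd_weight_abs k : Rabs (odd_weight a k) = (2 * INR k + 1) * Rabs (a k).
Proof.
  unfold odd_weight; rewrite Rabs_mult, Rabs_pos_eq; [reflexivity|].
  assert (H := pos_INR k); lra.
Qed.

Lemma Cpow_odd z n : Cpow z (2 * n + 1) = Cmult z (Cpow (Cmult z z) n).
Proof.
  rewrite Cpow_add_r, Cpow_mult_r, Cpow_1_r; simpl (Cpow z 2).
  rewrite Cmult_1_r; ring.
Qed.

Lemma odd_series_is z :
  is_Cseries (fun n => Cmult (RtoC (a n)) (Cpow z (2 * n + 1)%nat)) (odd_series a z).
Proof.
  apply CSeries_correct with
    (fun k => Cmod z * (Rabs (odd_weight a k) * Cmod (Cmult z z) ^ k)).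
  - intros n; rewrite Cpow_odd, !Cmod_mult, Cmod_R, Cmod_pow, Cmod_mult, odd_weight_abs.
    assert (H1 := pos_INR n); assert (H2 := Rabs_pos (a n)); assert (H3 := Cmod_ge_0 z).
    assert (H4 : 0 <= (Cmod z * Cmod z) ^ n) by (apply pow_le, Rmult_le_pos; exact H3).
    assert (0 <= 2 * INR n * (Cmod z * (Rabs (a n) * (Cmod z * Cmod z) ^ n))).
    { apply Rmult_le_pos; [lra|]; repeat apply Rmult_le_pos; assumption. }
    lra.
  - apply (ex_series_scal (Cmod z) (fun k => Rabs (odd_weight a k) * Cmod (Cmult z z) ^ k)), Ha.
Qed.

Lemma pterm_is (b : nat -> R) w : (forall k, Rabs (b k) <= Rabs (odd_weight a k)) ->
  is_Cseries (pterm b w) (CSeries (pterm b w)).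
Proof.
  intros Hb; apply CSeries_correct with (2 := Ha (Cmod w)).
  intros n; rewrite Cmod_pterm; apply Rmult_le_compat_r; [apply pow_le, Cmod_ge_0|apply Hb].
Qed.

Lemma abs_le_odd_weight k : Rabs (a k) <= Rabs (odd_weight a k).
Proof.
  rewrite odd_weight_abs; assert (H1 := pos_INR k); assert (H2 := Rabs_pos (a k)); nra.
Qed.

Lemma ntimes_le_odd_weight k : Rabs (ntimes a k) <= Rabs (odd_weight a k).
Proof.
  rewrite odd_weight_abs; unfold ntimes; rewrite Rabs_mult, (Rabs_pos_eq (INR k)) by apply pos_INR.
  assert (H1 := pos_INR k); assert (H2 := Rabs_pos (a k)); nra.
Qed.

Lemma odd_series_eq z : odd_series a z = Cmult z (CSeries (pterm a (Cmult z z))).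
Proof.
  apply CSeries_unique.
  eapply is_series_ext.
  2: { apply is_Cseries_scal, pterm_is, abs_le_odd_weight. }
  intros n; cbv beta; unfold pterm; rewrite Cpow_odd.
  match goal with |- ?x = ?y => change (x = y :> C) end; ring.
Qed.

Lemma odd_weight_pterm w : CSeries (pterm (odd_weight a) w)
  = Cplus (CSeries (pterm a w)) (Cmult (RtoC 2) (CSeries (pterm (ntimes a) w))).
Proof.
  apply CSeries_unique.
  assert (H1 := pterm_is a w abs_le_odd_weight).
  assert (H2 := is_Cseries_scal (RtoC (-2)) _ _ (pterm_is (ntimes a) w ntimes_le_odd_weight)).
  assert (H3 := is_Cseries_minus _ _ _ _ H1 H2).
  match type of H3 with is_series _ ?l => match goal with |- is_series _ ?m =>
    replace m with l end end.
  - refine (is_series_ext _ _ _ _ H3); intros n.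
    unfold pterm, odd_weight, ntimes; rewrite !RtoC_mult, RtoC_plus, RtoC_mult.
    replace (RtoC (-2)) with (Copp (RtoC 2)) by (rewrite <- RtoC_opp; f_equal; ring).
    match goal with |- ?x = ?y => change (x = y :> C) end; ring.
  - replace (RtoC (-2)) with (Copp (RtoC 2)) by (rewrite <- RtoC_opp; f_equal; ring).
    ring.
Qed.

Lemma odd_series_derive z :
  is_derive (K := C_AbsRing) (V := C_NormedModule) (odd_series a) z
    (CSeries (pterm (odd_weight a) (Cmult z z))).
Proof.
  set (r := Cmod z + 1).
  assert (Hz := Cmod_ge_0 z).
  (* The radius r = |z| + 1 covers all increments of modulus at most 1, and the 3 absorbs the extra
     2n+1. *)
  set (b := fun n => Rabs (odd_weight a n) * (3 * (r * r)) ^ n).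
  assert (Hb : ex_series b) by apply Ha.
  assert (Hb0 : 0 <= Series b).
  { apply Series_ge0; [|exact Hb].
    intros k; apply Rmult_le_pos; [apply Rabs_pos|apply pow_le]; unfold r; nra. }
  apply is_derive_C_quadratic with (2 * Series b); [lra|].
  intros k Hk.
  assert (H1 := is_Cseries_minus _ _ _ _ (odd_series_is (Cplus z k)) (odd_series_is z)).
  assert (H2 := is_Cseries_scal k _ _
           (pterm_is (odd_weight a) (Cmult z z) (fun n => Rle_refl _))).
  assert (H3 := is_Cseries_minus _ _ _ _ H1 H2).
  rewrite <- (CSeries_unique _ _ H3).
  rewrite (Rmult_assoc 2), (Rmult_comm (Series b)), <- Series_scal_l.
  apply CSeries_Cmod_le.
  2: { exact (ex_series_scal (Cmod k ^ 2) b Hb). }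
  intros n.
  assert (E : Cmod (Cminus (Cminus (Cmult (RtoC (a n)) (Cpow (Cplus z k) (2 * n + 1)))
               (Cmult (RtoC (a n)) (Cpow z (2 * n + 1))))
               (Cmult k (pterm (odd_weight a) (Cmult z z) n)))
            = Rabs (a n) * Cmod (Cminus (Cminus (Cpow (Cplus z k) (S (2 * n))) (Cpow z (S (2 * n))))
               (Cmult k (Cmult (RtoC (INR (S (2 * n)))) (Cpow z (2 * n)))))).
  { rewrite <- Cmod_R, <- Cmod_mult; f_equal.
    replace (2 * n + 1)%nat with (S (2 * n)) by lia.
    unfold pterm, odd_weight; rewrite (Cpow_mult_r z 2 n).
    replace (Cpow z 2) with (Cmult z z) by (simpl; ring).
    rewrite S_INR, mult_INR; simpl (INR 2).
    rewrite RtoC_mult; replace (1 + 1) with 2 by ring; ring. }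
  rewrite E.
  assert (Hrem := Cpow_remainder z k r (2 * n)).
  assert (Htri := Cmod_triangle z k).
  specialize (Hrem ltac:(unfold r; lra) ltac:(unfold r; lra) ltac:(unfold r; lra)).
  assert (Han := Rabs_pos (a n)).
  eapply Rle_trans; [apply Rmult_le_compat_l; [exact Han|exact Hrem]|].
  unfold b; rewrite odd_weight_abs, Rpow_mult_distr, pow_mult, S_INR, mult_INR.
  simpl (INR 2); replace (r ^ 2) with (r * r) by ring.
  assert (H3n := odd_le_pow3 n); assert (Hn := pos_INR n).
  assert (Hk2 : 0 <= Cmod k ^ 2) by apply pow2_ge_0.
  assert (Hrr : 0 <= (r * r) ^ n) by (apply pow_le; unfold r; nra).
  replace (Rabs (a n) * (((1 + 1) * INR n + 1) ^ 2 * (r * r) ^ n * Cmod k ^ 2))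
    with (Cmod k ^ 2 * ((2 * INR n + 1) * Rabs (a n) * ((2 * INR n + 1) * (r * r) ^ n)))
    by ring.
  apply Rmult_le_compat_l; [exact Hk2|].
  apply Rmult_le_compat_l; [apply Rmult_le_pos; lra|].
  apply Rmult_le_compat_r; [exact Hrr|exact H3n].
Qed.

End OddSeries.

(** * The radius of starlikeness *)

Lemma CSeries_ext (a b : nat -> C) : (forall n, a n = b n) -> CSeries a = CSeries b.
Proof. intros H; unfold CSeries; f_equal; apply Series_ext; intros n; now rewrite H. Qed.

Lemma CSeries_pterm_RtoC c x : CSeries (pterm c (RtoC x)) = RtoC (PSeries c x).
Proof.
  rewrite (CSeries_ext _ (fun n => RtoC (c n * x ^ n))) by (intros; apply pterm_RtoC).
  unfold CSeries, RtoC; simpl; f_equal.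
  apply is_series_unique, (is_lim_seq_ext (fun _ => 0) _ 0); [|apply is_lim_seq_const].
  intros n; rewrite sum_n_const; ring.
Qed.

Section Radius.

Variables (a : nat -> R) (f : C -> C) (gam : R).
Hypothesis Ha : forall x, ex_series (fun k => Rabs (odd_weight a k) * x ^ k).
Hypothesis Hf : forall z, f z = odd_series a z.
Hypothesis Hgam : 0 < gam.
Hypothesis Hroot : PSeries (odd_weight a) gam = 0.
Hypothesis Hdom : forall w, Cmod w < gam ->
  2 * Cmod (CSeries (pterm (ntimes a) w)) < Cmod (CSeries (pterm a w)).

Lemma odd_series_fun_derive z : is_derive (K := C_AbsRing) (V := C_NormedModule) f z
                     (CSeries (pterm (odd_weight a) (Cmult z z))).
Proof.
  apply is_derive_ext with (odd_series a).
  - intros t; symmetry; apply Hf.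
  - now apply odd_series_derive.
Qed.

Lemma starlike_below r : r <= sqrt gam -> starlike_on f r.
Proof.
  intros Hr z Hz; eexists; split; [apply odd_series_fun_derive|].
  set (w := Cmult z z).
  assert (Hw : Cmod w < gam).
  { unfold w; rewrite Cmod_mult, <- (sqrt_sqrt gam) by lra.
    apply Rmult_le_0_lt_compat; lra. }
  assert (H := Hdom w Hw).
  rewrite Hf, odd_series_eq, odd_weight_pterm by exact Ha; fold w.
  set (P := CSeries (pterm a w)) in *; set (T := CSeries (pterm (ntimes a) w)) in *.
  assert (HT := Cmod_ge_0 T).
  assert (HP : P <> RtoC 0) by (intros E; rewrite E, Cmod_0 in H; lra).
  assert (HP0 := proj1 (Cmod_gt_0 P) HP).
  assert (Hz0 : z <> RtoC 0) by (apply Cmod_gt_0; lra).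
  replace (Cdiv (Cmult z (Cplus P (Cmult (RtoC 2) T))) (Cmult z P))
    with (Cplus (RtoC 1) (Cmult (RtoC 2) (Cdiv T P))).
  2: { field; split; assumption. }
  assert (Hq : Cmod (Cmult (RtoC 2) (Cdiv T P)) < 1).
  { rewrite Cmod_mult, Cmod_R, Rabs_pos_eq, Cmod_div by (lra || assumption).
    apply (Rmult_lt_reg_r (Cmod P)); [exact HP0|].
    unfold Rdiv; rewrite !Rmult_assoc, Rinv_l by lra; lra. }
  assert (HRe := re_le_Cmod (Cmult (RtoC 2) (Cdiv T P))).
  set (q := Cmult (RtoC 2) (Cdiv T P)) in *.
  change (0 < 1 + Re q).
  assert (Hq' : Rabs (Re q) < 1) by lra.
  apply Rabs_def2 in Hq'; lra.
Qed.

Lemma not_starlike_beyond r : sqrt gam < r -> ~ starlike_on f r.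
Proof.
  intros Hr H.
  assert (Hs := sqrt_lt_R0 gam Hgam).
  destruct (H (RtoC (sqrt gam))) as (l & Hl & HRe).
  { rewrite Cmod_R, Rabs_pos_eq; lra. }
  apply is_C_derive_unique in Hl.
  rewrite (is_C_derive_unique _ _ _ (odd_series_fun_derive (RtoC (sqrt gam)))) in Hl.
  rewrite <- RtoC_mult, sqrt_sqrt, CSeries_pterm_RtoC, Hroot in Hl by lra.
  (* The derivative is 0 at this point, so the quotient is 0 whatever the inverse of [f] there. *)
  rewrite <- Hl, Cmult_0_r in HRe; unfold Cdiv in HRe; rewrite Cmult_0_l in HRe.
  simpl in HRe; lra.
Qed.

Lemma radius_starlike_odd_series : radius_starlike f = Finite (sqrt gam).
Proof.
  apply is_lub_Rbar_unique; split.
  - intros r [Hr Hst]; simpl; apply Rnot_lt_le; intros Hlt.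
    now apply (not_starlike_beyond r).
  - intros b Hb; apply Hb; split; [now apply sqrt_lt_R0|].
    apply starlike_below; lra.
Qed.

End Radius.

(** * Positivity of the infinite q-Pochhammer symbols *)

Section QPochhammerLimit.

Variables a q : R.
Hypothesis Hq : 0 < q < 1.
Hypothesis Ha : 0 < a < 1.

(** Each factor satisfies 1 - a q^k >= exp(-a q^k/(1 - a)), and the exponents form a geometric
    sum. *)
Lemma qpoch_lower n : exp (- (a * (1 - q ^ n) / ((1 - a) * (1 - q)))) <= qpoch a q n.
Proof.
  induction n as [|n IH]; simpl.
  - replace (- (a * (1 - 1) / ((1 - a) * (1 - q)))) with 0 by (field; lra).
    rewrite exp_0; lra.
  - assert (Hp := pow_lt_1 q n Hq).
    replace (- (a * (1 - q * q ^ n) / ((1 - a) * (1 - q))))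
      with (- (a * (1 - q ^ n) / ((1 - a) * (1 - q))) + - (a * q ^ n / (1 - a)))
      by (field; lra).
    rewrite exp_plus; apply Rmult_le_compat; try (left; apply exp_pos); [exact IH|].
    apply one_minus_ge_exp; nra.
Qed.

(** Needed to cancel [c_nu] against the prefactor of the Bessel function and to know that this
    prefactor does not affect the sign of the radial equation. *)
Lemma qpoch_inf_pos : 0 < qpoch_inf a q.
Proof.
  set (m := exp (- (a / ((1 - a) * (1 - q))))).
  assert (Hm : forall n, m <= qpoch a q n).
  { intros n; apply Rle_trans with (2 := qpoch_lower n).
    assert (Hp := pow_lt_1 q n Hq).
    assert (Hle : - (a / ((1 - a) * (1 - q))) <= - (a * (1 - q ^ n) / ((1 - a) * (1 - q)))).
    { apply Ropp_le_contravar, Rmult_le_compat_r; [|nra].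
      left; apply Rinv_0_lt_compat, Rmult_lt_0_compat; lra. }
    destruct Hle as [Hlt|Heq]; [left; now apply exp_increasing|].
    unfold m; rewrite Heq; apply Rle_refl. }
  destruct (ex_finite_lim_seq_decr (qpoch a q) m) as [l Hl].
  - intros n; simpl.
    assert (H1 := qpoch_pos a q n Hq Ha); assert (Hp := pow_lt_1 q n Hq).
    rewrite <- (Rmult_1_r (qpoch a q n)) at 2.
    apply Rmult_le_compat_l; [lra|nra].
  - exact Hm.
  - unfold qpoch_inf; rewrite (is_lim_seq_unique (fun n => qpoch a q n) l Hl); simpl.
    apply Rlt_le_trans with m; [apply exp_pos|].
    apply (is_lim_seq_le _ _ m l Hm); [apply is_lim_seq_const|exact Hl].
Qed.

End QPochhammerLimit.

Lemma Rpower_triangular q n : 0 < q ->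
  Rpower q (INR n * (INR n + 1) / 2) = q ^ n * wprod q 0 n.
Proof.
  intros Hq; induction n as [|n IH].
  - simpl; replace (0 * (0 + 1) / 2) with 0 by field; rewrite Rpower_O by exact Hq; ring.
  - replace (INR (S n) * (INR (S n) + 1) / 2)
      with (INR n * (INR n + 1) / 2 + INR (S n)) by (rewrite S_INR; field).
    rewrite Rpower_plus, IH, Rpower_pow by exact Hq; simpl; ring.
Qed.

(** * Specialization to the Hahn-Exton function *)

Section HahnExton.

Variables q nu : R.
Hypothesis Hq : 0 < q < 1.
Hypothesis Hnu : -1 < nu.

Let c := Rpower q (nu + 1).
Let h := wcoef q c 0.
Let e := odd_weight h.

Lemma c_bounds : 0 < c < 1.
Proof.
  split; [apply exp_pos|].
  apply Rlt_le_trans with (exp 0); [|rewrite exp_0; lra].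
  apply exp_increasing.
  assert (Hln : ln q < 0) by (rewrite <- ln_1; apply ln_increasing; lra).
  nra.
Qed.

Lemma hex_coef_alt n : hex_coef nu q n = alt h n.
Proof.
  unfold hex_coef, alt, h, wcoef; rewrite Rpower_triangular by lra; fold c.
  unfold Rdiv; ring.
Qed.

Lemma Rpower_q_add k : Rpower q (nu + 1 + INR k) = c * q ^ k.
Proof. rewrite Rpower_plus, Rpower_pow by lra; reflexivity. Qed.

Lemma prefactor_pos : 0 < qpoch_inf c q / qpoch_inf q q.
Proof. apply Rdiv_lt_0_compat; apply qpoch_inf_pos; (exact Hq || apply c_bounds). Qed.

Lemma g3_odd_series z : g3 nu q z = odd_series (alt h) z.
Proof.
  unfold g3, c_nu; fold c.
  assert (H1 := qpoch_inf_pos c q Hq c_bounds); assert (H2 := qpoch_inf_pos q q Hq Hq).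
  rewrite Cmult_assoc, <- RtoC_mult.
  replace (qpoch_inf q q / qpoch_inf c q * (qpoch_inf c q / qpoch_inf q q)) with 1
    by (field; lra).
  rewrite Cmult_1_l; apply CSeries_ext; intros n; now rewrite hex_coef_alt.
Qed.

Lemma h_pos k : 0 < h k.
Proof. apply wcoef_pos; [exact Hq|apply c_bounds]. Qed.

Lemma e_pos k : 0 < e k.
Proof. apply odd_weight_pos, h_pos. Qed.

Lemma e_ratio : is_lim_seq (fun k => INR (S k) * (e (S k) / e k)) 0.
Proof. apply odd_weight_ratio_lim; [exact Hq|apply c_bounds]. Qed.

Lemma ex_series_odd_weight_alt x : ex_series (fun k => Rabs (odd_weight (alt h) k) * x ^ k).
Proof.
  apply ex_series_ext with (2 := ex_series_entire e e_pos e_ratio x).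
  intros k; rewrite odd_weight_alt_abs; [reflexivity|exact h_pos].
Qed.

Lemma CV_radius_alt_h : CV_radius (alt h) = p_infty.
Proof.
  apply CV_radius_alt; [exact h_pos|].
  apply is_lim_seq_0_abs_le with (fun k => INR (S k) * (e (S k) / e k)); [|exact e_ratio].
  intros k; assert (H1 := h_pos k); assert (H2 := h_pos (S k)).
  assert (Hk := pos_INR k); assert (HS : 0 < INR (S k)) by (apply lt_0_INR; lia).
  assert (H3 : 0 < h (S k) / h k) by now apply Rdiv_lt_0_compat.
  rewrite Rabs_pos_eq by (apply Rmult_le_pos; lra).
  apply Rmult_le_compat_l; [lra|].
  unfold e, odd_weight; rewrite S_INR.
  replace ((2 * (INR k + 1) + 1) * h (S k) / ((2 * INR k + 1) * h k))
    with (h (S k) / h k + 2 / (2 * INR k + 1) * (h (S k) / h k)) by (field; lra).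
  assert (0 < 2 / (2 * INR k + 1)) by (apply Rdiv_lt_0_compat; lra).
  assert (0 < 2 / (2 * INR k + 1) * (h (S k) / h k)) by now apply Rmult_lt_0_compat.
  lra.
Qed.

Lemma J3_eq x : 0 < x -> J3 nu q x
  = qpoch_inf c q / qpoch_inf q q * (Rpower x nu * PSeries (alt h) (x ^ 2)).
Proof.
  intros Hx; unfold J3; fold c; f_equal.
  unfold PSeries; rewrite <- Series_scal_l; apply Series_ext; intros n.
  rewrite hex_coef_alt, Rpower_plus.
  replace (2 * INR n) with (INR (2 * n)) by (rewrite mult_INR; simpl; ring).
  rewrite Rpower_pow, pow_mult by exact Hx; ring.
Qed.

Lemma PSeries_derive_incr x :
  x * PSeries (PS_derive (alt h)) x = PSeries (ntimes (alt h)) x.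
Proof.
  rewrite <- PSeries_incr_1; apply PSeries_ext; intros [|n].
  - unfold ntimes; simpl; rewrite Rmult_0_l; reflexivity.
  - reflexivity.
Qed.

(** The operator x d/dx sends x^nu P(x^2) to x^nu (nu P + 2 x^2 P'); subtracting nu - 1 times the
    function leaves the coefficient 1 of P in P + 2 w P' at w = x^2. *)
Lemma J3_equation x : 0 < x ->
  x * Derive (J3 nu q) x - (nu - 1) * J3 nu q x
  = qpoch_inf c q / qpoch_inf q q * Rpower x nu * PSeries (alt e) (x ^ 2).
Proof.
  intros Hx.
  set (K := qpoch_inf c q / qpoch_inf q q).
  assert (HPs : is_derive (PSeries (alt h)) (x ^ 2) (PSeries (PS_derive (alt h)) (x ^ 2))).
  { apply is_derive_PSeries; rewrite CV_radius_alt_h; exact I. }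
  assert (Hd : is_derive (J3 nu q) x
    (K * (nu / x * Rpower x nu * PSeries (alt h) (x ^ 2)
          + Rpower x nu * (2 * x * PSeries (PS_derive (alt h)) (x ^ 2))))).
  { apply is_derive_ext_loc with (fun y => K * (Rpower y nu * PSeries (alt h) (y ^ 2))).
    (* The formula of [J3_eq] holds only for positive arguments, and the ball of radius x around x
       stays there. *)
    - exists (mkposreal x Hx); intros y Hy.
      apply Rabs_def2 in Hy; unfold minus, plus, opp in Hy; simpl in Hy.
      symmetry; apply J3_eq; lra.
    - apply is_derive_scal.
      apply (is_derive_mult (fun y => Rpower y nu) (fun y => PSeries (alt h) (y ^ 2))).
      + unfold Rpower; auto_derive; [exact Hx|field; lra].
      + apply (is_derive_comp (PSeries (alt h)) (fun y => y ^ 2)); [exact HPs|].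
        auto_derive; [exact I|ring].
      + intros; apply Rmult_comm. }
  rewrite (is_derive_unique _ _ _ Hd), J3_eq by exact Hx; fold K.
  replace (PSeries (alt e) (x ^ 2))
    with (PSeries (alt h) (x ^ 2) + 2 * (x ^ 2 * PSeries (PS_derive (alt h)) (x ^ 2))).
  - field; lra.
  - rewrite PSeries_derive_incr, <- PSeries_odd_weight by apply ex_series_odd_weight_alt.
    apply PSeries_ext; intros k; apply odd_weight_alt.
Qed.

Lemma hahn_exton_first_root : exists gam,
  0 < gam /\ PSeries (alt e) gam = 0 /\ (forall y, 0 <= y < gam -> 0 < PSeries (alt e) y) /\
  1 < gam * e 1%nat /\
  gam * (e 1%nat ^ 2 - 2 * e 2%nat) < e 1%nat /\
  1 < gam ^ 2 * (e 1%nat ^ 2 - 2 * e 2%nat) /\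
  gam * (e 1%nat ^ 3 - 3 * e 1%nat * e 2%nat + 3 * e 3%nat) < e 1%nat ^ 2 - 2 * e 2%nat /\
  0 < e 1%nat ^ 3 - 3 * e 1%nat * e 2%nat + 3 * e 3%nat /\
  radius_starlike (g3 nu q) = Finite (sqrt gam).
Proof.
  destruct (real_rooted_approximants q c Hq c_bounds)
    as (L & L' & HL & HL' & HLL & HE' & HE).
  assert (HEL : forall N k, esym (L N) k = odd_weight (esym (L' N)) k)
    by (intros N k; rewrite HE; unfold odd_weight; now rewrite HE').
  assert (Hle : forall N k, esym (L' N) k <= h k)
    by (intros N k; rewrite HE'; apply wcoef_le; [exact Hq|apply c_bounds]).
  assert (Hlim : forall k, is_lim_seq (fun N => esym (L' N) k) (h k)).
  { intros k; apply is_lim_seq_ext with (fun N => wcoef q c (q ^ N) k).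
    - intros N; symmetry; apply HE'.
    - apply wcoef_lim; exact Hq. }
  assert (He0 : e 0%nat = 1) by (unfold e, odd_weight, h, wcoef; simpl; field).
  destruct (euler_rayleigh L e HL e_pos He0
              (odd_weight_esym_le L L' h HEL Hle) (odd_weight_esym_lim L L' h HEL Hlim)
              e_ratio) as (gam & Hg & Hroot & Hbelow & H1 & H2 & H3 & H4 & H5).
  exists gam; repeat split; try assumption.
  apply (radius_starlike_odd_series (alt h)).
  - exact ex_series_odd_weight_alt.
  - exact g3_odd_series.
  - exact Hg.
  - rewrite <- Hroot; apply PSeries_ext; intros k; apply odd_weight_alt.
  - intros w Hw.
    exact (theta_dominated L L' h HL HL' HLL HEL Hle Hlim h_pos e_ratio gam w Hw Hbelow).
Qed.

Lemma e_1 : e 1%nat = 3 * q / ((1 - q) * (1 - c)).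
Proof.
  assert (Hc := c_bounds).
  unfold e, odd_weight, h, wcoef; simpl; field; lra.
Qed.

Lemma e_2 : e 2%nat = 5 * q ^ 3 / ((1 - q) * (1 - q * q) * (1 - c) * (1 - c * q)).
Proof.
  assert (Hc := c_bounds).
  assert (0 < 1 - q * q) by nra; assert (0 < 1 - c * q) by nra.
  unfold e, odd_weight, h, wcoef; simpl; field; lra.
Qed.

Lemma e_3 : e 3%nat = 7 * q ^ 6 / ((1 - q) * (1 - q * q) * (1 - q * (q * q))
                         * (1 - c) * (1 - c * q) * (1 - c * (q * q))).
Proof.
  assert (Hc := c_bounds).
  assert (0 < q * q < 1) by nra; assert (0 < 1 - c * q) by nra.
  assert (0 < 1 - q * (q * q)) by nra; assert (0 < 1 - c * (q * q)) by nra.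
  unfold e, odd_weight, h, wcoef; simpl; field; lra.
Qed.

End HahnExton.

(** With gam the square of the radius, the bounds say 1/p1 < gam < p1/p2 and p2^(-1/2) < gam <
    p2/p3. Here [D] is a negative multiple of p2 and [s + r] a positive multiple of p3. *)
Theorem theorem5 (q nu : R) (hq0 : 0 < q) (hq1 : q < 1) (hnu : -1 < nu) :
  let a1 := Rpower q (nu + 1) in
  let a2 := Rpower q (nu + 2) in
  let a3 := Rpower q (nu + 3) in
  let D := 9 * a3 - a2 + q - 9 in
  let s := 6 * a2 - 12 * a3 - 20 * Rpower q (nu + 4) - 12 * Rpower q (nu + 5)
           + 6 * Rpower q (nu + 6) + Rpower q (2 * nu + 5) in
  let r := 3 * Rpower q (2 * nu + 6) + 3 * Rpower q (2 * nu + 7)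
           + 9 * Rpower q (2 * nu + 8) + q ^ 3 + 3 * q ^ 2 + 3 * q + 9 in
  let qs := D * (q ^ 3 + 2 * q ^ 2 + 2 * q + 1) / (s + r) in
  let F := fun x => x * Derive (J3 nu q) x - (nu - 1) * J3 nu q x in
  exists rs : R,
    radius_starlike (g3 nu q) = Finite rs /\
    (* rs is the smallest positive root of F *)
    0 < rs /\ F rs = 0 /\ (forall x, 0 < x < rs -> F x <> 0) /\
    sqrt ((1 - q) * (1 - a1) / (3 * q)) < rs /\
    rs < sqrt (3 * (a1 - 1) * (a2 - 1) * (q ^ 2 - 1) / (q * D)) /\
    Rpower ((a1 - 1) ^ 2 * (q - 1) ^ 2 * (a2 - 1) * (q + 1) / (q ^ 2 * D)) (1 / 4)
      < rs /\
    rs < sqrt ((q - 1) * (a1 - 1) * (a3 - 1) / (3 * q * (q + 1)) * qs).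
Proof.
  intros a1 a2 a3 D s r qs F.
  assert (Hq : 0 < q < 1) by (split; assumption).
  assert (Hc := c_bounds q nu Hq hnu); fold a1 in Hc.
  assert (Hadd : forall k u, u = nu + 1 + INR k -> Rpower q u = a1 * q ^ k)
    by (intros k u ->; now apply Rpower_q_add).
  assert (Hadd2 : forall k u, u = (nu + 1) + (nu + 1 + INR k) ->
                  Rpower q u = a1 * a1 * q ^ k).
  { intros k u ->; rewrite Rpower_plus, Rpower_q_add by assumption; unfold a1; ring. }
  assert (E2 : a2 = a1 * q ^ 1) by (apply Hadd; simpl; ring).
  assert (E3 : a3 = a1 * q ^ 2) by (apply Hadd; simpl; ring).
  assert (E4 : Rpower q (nu + 4) = a1 * q ^ 3) by (apply Hadd; simpl; ring).
  assert (E5 : Rpower q (nu + 5) = a1 * q ^ 4) by (apply Hadd; simpl; ring).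
  assert (E6 : Rpower q (nu + 6) = a1 * q ^ 5) by (apply Hadd; simpl; ring).
  assert (E25 : Rpower q (2 * nu + 5) = a1 * a1 * q ^ 3) by (apply Hadd2; simpl; ring).
  assert (E26 : Rpower q (2 * nu + 6) = a1 * a1 * q ^ 4) by (apply Hadd2; simpl; ring).
  assert (E27 : Rpower q (2 * nu + 7) = a1 * a1 * q ^ 5) by (apply Hadd2; simpl; ring).
  assert (E28 : Rpower q (2 * nu + 8) = a1 * a1 * q ^ 6) by (apply Hadd2; simpl; ring).
  destruct (hahn_exton_first_root q nu Hq hnu)
    as (gam & Hg & Hroot & Hbelow & H1 & H2 & H3 & H4 & H5 & Hrad).
  assert (Hs := sqrt_lt_R0 gam Hg).
  set (e := odd_weight (wcoef q (Rpower q (nu + 1)) 0)) in *.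
  set (p2 := e 1%nat ^ 2 - 2 * e 2%nat) in *.
  set (p3 := e 1%nat ^ 3 - 3 * e 1%nat * e 2%nat + 3 * e 3%nat) in *.
  assert (V1 : e 1%nat = 3 * q / ((1 - q) * (1 - a1))) by now apply e_1.
  assert (Hqq : 0 < q * q < 1) by nra.
  assert (Hqqq : 0 < q * (q * q) < 1) by nra.
  assert (Hcq : 0 < a1 * q < 1) by nra.
  assert (Hcqq : 0 < a1 * (q * q) < 1) by nra.
  assert (V2 : p2 = - (q ^ 2 * D) / ((1 - q) ^ 2 * (1 - a1) ^ 2 * (1 + q) * (1 - a1 * q))).
  { unfold p2, D, e; rewrite e_1, e_2 by assumption; fold a1; rewrite E2, E3.
    field; lra. }
  (* The cubic in q is (1 + q)(1 + q + q^2), what remains of 1 - q^2 and 1 - q^3 after removing 1 -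
     q from each. *)
  assert (V3 : p3 = 3 * q ^ 3 * (s + r) / ((1 - q) ^ 3 * (1 - a1) ^ 3 * (1 - a1 * q)
                 * (1 - a1 * (q * q)) * (q ^ 3 + 2 * q ^ 2 + 2 * q + 1))).
  { unfold p3, s, r, e; rewrite e_1, e_2, e_3 by assumption; fold a1.
    rewrite E2, E3, E4, E5, E6, E25, E26, E27, E28.
    assert (0 < q ^ 3 + 2 * q ^ 2 + 2 * q + 1) by (simpl; nra).
    field; lra. }
  assert (Hgam2 : 0 < gam ^ 2) by now apply pow_lt.
  assert (Hp2 : 0 < p2).
  { apply (Rmult_lt_reg_l (gam ^ 2)); [exact Hgam2|lra]. }
  (* Nonvanishing of [D], and then of [s + r], is read off from the positivity of [p2] and [p3],
     without estimating the polynomials. *)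
  assert (HD : D <> 0).
  { intros E; rewrite V2, E in Hp2; unfold Rdiv in Hp2.
    rewrite Rmult_0_r, Ropp_0, Rmult_0_l in Hp2; lra. }
  assert (Hsr : s + r <> 0).
  { intros E; rewrite V3, E in H5; unfold Rdiv in H5.
    rewrite Rmult_0_r, Rmult_0_l in H5; lra. }
  assert (Hlt_div : forall x u v, 0 < v -> x * v < u -> x < u / v).
  { intros x u v Hv Hx; apply (Rmult_lt_reg_r v); [exact Hv|].
    unfold Rdiv; rewrite Rmult_assoc, Rinv_l; lra. }
  assert (Hdiv_lt : forall x u v, 0 < v -> u < x * v -> u / v < x).
  { intros x u v Hv Hx; apply (Rmult_lt_reg_r v); [exact Hv|].
    unfold Rdiv; rewrite Rmult_assoc, Rinv_l; lra. }
  assert (He1 : 0 < e 1%nat) by (apply (Rmult_lt_reg_l gam); lra).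
  exists (sqrt gam); split; [exact Hrad|].
  split; [exact Hs|].
  split; [|split; [|split; [|split; [|split]]]].
  - unfold F; rewrite J3_equation by assumption; fold e.
    replace (sqrt gam ^ 2) with gam by (simpl; rewrite Rmult_1_r, sqrt_sqrt; lra).
    rewrite Hroot; ring.
  - intros x Hx; unfold F; rewrite J3_equation by (assumption || lra); fold e.
    apply Rgt_not_eq, Rmult_lt_0_compat.
    + apply Rmult_lt_0_compat; [now apply prefactor_pos|apply exp_pos].
    + apply Hbelow; split; [apply pow2_ge_0|].
      rewrite <- (sqrt_sqrt gam) by lra; simpl; rewrite Rmult_1_r.
      apply Rmult_le_0_lt_compat; lra.
  - replace ((1 - q) * (1 - a1) / (3 * q)) with (1 / e 1%nat) by (rewrite V1; field; lra).
    apply sqrt_lt_1_alt; split; [left; apply Rdiv_lt_0_compat; lra|].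
    apply Hdiv_lt; lra.
  - replace (3 * (a1 - 1) * (a2 - 1) * (q ^ 2 - 1) / (q * D)) with (e 1%nat / p2).
    + apply sqrt_lt_1_alt; split; [lra|]; apply Hlt_div; lra.
    + rewrite V1, V2, E2; field; repeat split; lra.
  - replace ((a1 - 1) ^ 2 * (q - 1) ^ 2 * (a2 - 1) * (q + 1) / (q ^ 2 * D)) with (1 / p2).
    (* The bound is 1/p2 < gam^2 while the radius is sqrt gam, whence the fourth root. *)
    + replace (sqrt gam) with (Rpower (gam ^ 2) (1 / 4)).
      * apply Rlt_Rpower_l; [lra|]; split; [apply Rdiv_lt_0_compat; lra|].
        apply Hdiv_lt; lra.
      * rewrite <- Rpower_pow, Rpower_mult by exact Hg.
        replace (INR 2 * (1 / 4)) with (/ 2) by (simpl; field).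
        now apply Rpower_sqrt.
    + rewrite V2, E2; field; repeat split; lra.
  - replace ((q - 1) * (a1 - 1) * (a3 - 1) / (3 * q * (q + 1)) * qs) with (p2 / p3).
    + apply sqrt_lt_1_alt; split; [lra|]; apply Hlt_div; lra.
    + assert (0 < q ^ 3 + 2 * q ^ 2 + 2 * q + 1) by (simpl; nra).
      unfold qs; rewrite V2, V3, E3; field; repeat split; lra.
Qed.
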